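(* Let $0\le m\le n$. Every Suslin set $A\subset\Upsilon(\mathbb R^n)$ belongs to $\mathscr D^m$; that is, for every $r>0$ and every $k\in\mathbb N$ the map $$\Upsilon(B_r^c)\ni\eta\mapsto\mathsf S^{m,k}_{B_r}(A^k_{\eta,r})$$ is $\pi_{B_r^c}$-measurable.
   Context: $B_r\subset\mathbb R^n$ is the closed ball of radius $r>0$ centred at $0$, $B_r^c$ its complement. $\Upsilon(\mathbb R^n)$ is the set of locally finite point measures $\gamma=\sum_i\delta_{x_i}$ on $\mathbb R^n$ with $\gamma(\{x\})\in\{0,1\}$ for all $x$, with the vague topology (convergence against $C_c(\mathbb R^n)$; it is Polish). For $A\subset\mathbb R^n$, $\Upsilon(A)$ is the set of configurations concentrated on $A$ (relative topology), $\Upsilon^k(A)=\{\gamma\in\Upsilon(A):\gamma(A)=k\}$. $\pi_A$ is the Poisson measure on $\Upsilon(A)$ whose intensity is Lebesgue measure on $A$; $\pi_{B_r^c}$-measurable means measurable w.r.t. the completion of the Borel $\sigma$-algebra. A Suslin set is a set of the form $\bigcup_{\phi\in\mathbb N^{\mathbb N}}\bigcap_{l\ge1}E_{\phi|_l}$ with all $E_{\phi|_l}$ closed, $\phi|_l=(\phi_1,\dots,\phi_l)$ (equivalently, an analytic set). For $A\subset\Upsilon(\mathbb R^n)$ and $\eta\in\Upsilon(B_r^c)$: $A_{\eta,r}=\{\gamma\in\Upsilon(B_r):\gamma+\eta\in A\}$ and $A^k_{\eta,r}=A_{\eta,r}\cap\Upsilon^k(B_r)$. $\mathbf S^d$ is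 the $d$-dimensional spherical Hausdorff (outer) measure on Euclidean space: $\mathbf S^d(A)=\lim_{\varepsilon\to0}\inf\{\sum_i\omega_d2^{-d}\mathrm{diam}(B_i)^d\}$, the infimum over countable covers of $A$ by open balls of diameter $<\varepsilon$, with $\omega_d=\Gamma(1/2)^d/\Gamma(d/2+1)$. Let $\mathsf s_k:(x_1,\dots,x_k)\mapsto\sum_i\delta_{x_i}$ from $B_r^{\times k}$ minus the set of tuples with two equal entries to $\Upsilon^k(B_r)$, and $\mathsf S^{m,k}_{B_r}(A)=\frac1{k!}\mathbf S^{nk-m}(\mathsf s_k^{-1}(A))$ for $A\subset\Upsilon^k(B_r)$. $\mathscr D^m=\bigcap_{r>0}\mathscr D^m_r$, where $\mathscr D^m_r$ is the family of $A\subset\Upsilon(\mathbb R^n)$ such that $\eta\mapsto\mathsf S^{m,k}_{B_r}(A^k_{\eta,r})$ is $\pi_{B_r^c}$-measurable on $\Upsilon(B_r^c)$ for every $k$. *)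

(* Defs.v *)
From HB Require Import structures.
From mathcomp Require Import all_boot all_order all_algebra.
From mathcomp Require Import all_classical all_reals all_analysis.
From mathcomp Require Import measurable_realfun.

Set Implicit Arguments.
Unset Strict Implicit.
Unset Printing Implicit Defensive.

Import Order.TTheory GRing.Theory Num.Theory.
Import numFieldNormedType.Exports.

Local Open Scope classical_set_scope.
Local Open Scope ring_scope.

Section Euclidean.
Context {R : realType}.

(* The library's norm on matrices is the sup norm.  A point of (R^n)^k = R^(nk)
   is a k x n matrix whose rows are its k components; the norm below is the
   Euclidean norm of R^(nk), and that of R^n for k = 1. *)
Definition enorm {k n : nat} (x : 'M[R]_(k, n)) : R :=
  Num.sqrt (\sum_i \sum_j x i j ^+ 2).

Definition eball {k n : nat} (c : 'M[R]_(k, n)) (rho : R) : set 'M[R]_(k, n) :=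
  [set x | enorm (x - c) < rho].

Definition ediam {k n : nat} (B : set 'M[R]_(k, n)) : R :=
  sup [set enorm (x - y) | x in B & y in B].

Definition cball (n : nat) (r : R) : set 'rV[R]_n := [set x | enorm x <= r].

Definition gamma_fun (s : R) : R :=
  \int[lebesgue_measure]_(t in `]0, +oo[) (t `^ (s - 1) * expR (- t)).

Definition omega (d : R) : R := gamma_fun 2^-1 `^ d / gamma_fun (d / 2 + 1).

(* Covers are indexed by an arbitrary set D of naturals, so that finite (and
   empty) covers are allowed; this matters for d = 0. *)
Definition spherical_content {k n : nat} (d eps : R) (A : set 'M[R]_(k, n)) :
    \bar R :=
  ereal_inf [set v | exists (D : set nat) (c : nat -> 'M[R]_(k, n))
                            (rho : nat -> R),
    [/\ forall i, D i -> 0 < rho i /\ ediam (eball (c i) (rho i)) < eps,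
        A `<=` \bigcup_(i in D) eball (c i) (rho i) &
        v = \esum_(i in D)
              (omega d * 2 `^ (- d) * ediam (eball (c i) (rho i)) `^ d)%:E]].

Definition spherical_hausdorff {k n : nat} (d : R) (A : set 'M[R]_(k, n)) :
    \bar R :=
  lim (spherical_content d eps A @[eps --> 0^'+]).

Definition lebesgue_rV {n : nat} (A : set 'rV[R]_n) : \bar R :=
  ereal_inf [set v | exists (D : set nat) (a b : nat -> 'rV[R]_n),
    [/\ forall i j, a i ord0 j <= b i ord0 j,
        A `<=` \bigcup_(i in D)
                 [set x | forall j, a i ord0 j <= x ord0 j <= b i ord0 j] &
        v = \esum_(i in D) (\prod_j (b i ord0 j - a i ord0 j))%:E]].

End Euclidean.

Section Configurations.
Context {R : realType} {n : nat}.

Definition borel_rV := g_sigma_algebraType (@open 'rV[R]_n).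

(* The first condition prescribes gamma on all sets, not only on Borel ones, so
   equality of configurations is equality of the underlying Borel measures. *)
Definition is_config (gamma : {measure set borel_rV -> \bar R}) : Prop :=
  [/\ exists (D : set nat) (x : nat -> borel_rV),
        forall S : set 'rV[R]_n, gamma S = \esum_(i in D) \d_(x i) S,
      forall K : set 'rV[R]_n, compact K -> (gamma K < +oo)%E &
      forall x : 'rV[R]_n, gamma [set x] = 0%E \/ gamma [set x] = 1%E].

Record config := Config {
  config_measure :> {measure set borel_rV -> \bar R};
  config_measureP : is_config config_measure }.

Definition mass (gamma : config) : set 'rV[R]_n -> \bar R := gamma.

Definition Cc : set ('rV[R]_n -> R) :=
  [set f | continuous f /\ compact (closure [set x | f x != 0])].

HB.instance Definition _ := gen_eqMixin config.
HB.instance Definition _ := gen_choiceMixin config.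
(* The vague topology: the coarsest one for which all the maps
   gamma |-> \int f dgamma, f in C_c(R^n), are continuous. *)
HB.instance Definition _ := @isSubBaseTopological.Build config
  (('rV[R]_n -> R) * set R)%type
  [set fU | Cc fU.1 /\ open fU.2]
  (fun fU => [set gamma : config |
     fU.2 (\int[config_measure gamma]_(x in setT) fU.1 x)]).

Lemma is_config0 : is_config mzero.
Proof.
split=> [|K _|x]; last by left.
- by exists set0, (fun=> 0) => S; rewrite esum_set0.
- exact: ltry.
Qed.

Definition config0 : config := Config is_config0.

Definition Upsilon (A : set 'rV[R]_n) : set config :=
  [set gamma | mass gamma (~` A) = 0%E].

Lemma Upsilon_config0 A : config0 \in Upsilon A.
Proof. exact/mem_set. Qed.

Definition Upsilonk (k : nat) (A : set 'rV[R]_n) : set config :=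
  Upsilon A `&` [set gamma | mass gamma A = k%:R%:E].

(* Upsilon A as a type; [set_type] carries the relative topology. *)
Definition UpsilonT (A : set 'rV[R]_n) := set_type (Upsilon A).
HB.instance Definition _ A := Topological.on (UpsilonT A).
HB.instance Definition _ A := isPointed.Build (UpsilonT A)
  (exist _ config0 (Upsilon_config0 A)).

Definition borel_Upsilon (A : set 'rV[R]_n) :=
  g_sigma_algebraType (@open (UpsilonT A)).

Definition is_poisson (A : set 'rV[R]_n) (P : probability (borel_Upsilon A) R) :
    Prop :=
  forall (l : nat) (E : 'I_l -> set 'rV[R]_n) (k : 'I_l -> nat),
    (forall i, measurable (E i : set borel_rV)) ->
    (forall i, E i `<=` A /\ exists r, E i `<=` cball r) ->
    trivIset setT E ->
    P [set gamma : UpsilonT A | forall i, mass (set_val gamma) (E i)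
                                          = (k i)%:R%:E]
    = (\prod_i (expR (- fine (lebesgue_rV (E i)))
                * fine (lebesgue_rV (E i)) ^+ k i / (k i)`!%:R))%:E.

(* phi|_l is [mkseq phi l]. *)
Definition suslin (A : set config) : Prop :=
  exists E : seq nat -> set config, (forall s, closed (E s)) /\
    A = \bigcup_(phi in [set: nat -> nat])
          \bigcap_(l in [set l | (1 <= l)%N]) E (mkseq phi l).

(* The measure gamma + eta is the configuration zeta with
   mass zeta = mass gamma \+ mass eta. *)
Definition config_section (A : set config) (r : R) (eta : config) :
    set config :=
  Upsilon (cball r) `&`
  [set gamma | [set mass zeta | zeta in A] (mass gamma \+ mass eta)%E].

Definition config_sectionk (A : set config) (r : R) (k : nat) (eta : config) :
    set config :=
  config_section A r eta `&` Upsilonk k (cball r).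

Definition distinct_tuples {k : nat} (r : R) : set 'M[R]_(k, n) :=
  [set x | (forall i, cball r (row i x)) /\
           forall i j, i != j -> row i x != row j x].

Definition sk {k : nat} (x : 'M[R]_(k, n)) : set 'rV[R]_n -> \bar R :=
  fun S => (\sum_(i < k) \d_(row i x : borel_rV) S)%E.

Definition sk_preimage {k : nat} (r : R) (A : set config) :
    set 'M[R]_(k, n) :=
  distinct_tuples r `&` [set x | [set mass zeta | zeta in A] (sk x)].

(* For k = 0 and m > 0 the dimension n * k - m is negative; the power of the
   diameter 0 of balls of R^0 is then 0, and the value is 0. *)
Definition Smk (m : R) (k : nat) (r : R) (A : set config) : \bar R :=
  (k`!%:R^-1)%:E * spherical_hausdorff ((n * k)%:R - m)
    (sk_preimage r A : set 'M[R]_(k, n)).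

Definition completion_measurable {d : measure_display} {T : measurableType d}
    (P : probability T R) (f : T -> \bar R) : Prop :=
  forall Y : set (\bar R), measurable Y -> completed_algebra_gen P (f @^-1` Y).

(* "The" Poisson measure on Upsilon (~` cball r) is the (unique) probability
   satisfying [is_poisson]. *)
Definition Dr (m r : R) : set (set config) :=
  [set A | forall P : probability (borel_Upsilon (~` cball r)) R,
     is_poisson P -> forall k : nat,
     completion_measurable P
       (fun eta : UpsilonT (~` cball r) =>
          Smk m k r (config_sectionk A r k (set_val eta)))].

Definition Dm (m : R) : set (set config) :=
  \bigcap_(r in [set r : R | 0 < r]) Dr m r.

End Configurations.

Arguments config : clear implicits.

(* Main.v *)
Require Import Defs.
From HB Require Import structures.
From mathcomp Require Import all_boot all_order all_algebra.
From mathcomp Require Import all_classical all_reals all_analysis.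
From mathcomp Require Import measurable_realfun.
From mathcomp Require Import ring lra zify.

Set Implicit Arguments.
Unset Strict Implicit.
Unset Printing Implicit Defensive.

Import Order.TTheory GRing.Theory Num.Theory.
Import numFieldNormedType.Exports.

Local Open Scope classical_set_scope.
Local Open Scope ring_scope.

(** For fixed [r] and [k], let [X_eta] be the set of [k]-tuples of distinct
    points of the ball whose superposition with [eta] lies in [A].  The claim
    is that [eta |-> S^d(X_eta)] is measurable for the completion of [P], where
    [d = n k - m].  The relation [x \in X_eta] is a Suslin relation on a
    product: superposition is jointly continuous in [(x, eta)], and the tuples
    of distinct points form a countable union of compact sets.  So everything
    reduces to a statement on Suslin subsets of [C x Y], with [C] a compact set
    of tuples and [Y] a topological space carrying a Borel probability
    ([suslin_section_caratheodory]).

    That statement is Choquet's capacitability argument with a parameter, run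
    on the contents [S^d_e] (covers by balls of diameter less than [e]).  If
    the outer probability of the [y] with [S^d_e(X_y) > t] exceeds [a], one
    bounds the indices of the Suslin scheme one level at a time, keeping that
    outer probability above [a].  The bounded scheme is a decreasing sequence of
    closed sets whose intersection lies in the Suslin set by Koenig's lemma.
    For a closed set [K] of [C x Y] the map [y |-> S^d_e(K_y)] is upper
    semicontinuous by the tube lemma, because the covers are open, and along
    decreasing compact sets the contents pass to the limit.  This yields a
    measurable set of probability at least [a] inside [{S^d_(e/2)(X_y) >= t}].
    Letting [e] tend to [0], the level sets of [S^d(X_y)] have equal inner and
    outer probability.

    Each level of the bounding step needs the contents to be continuous along
    increasing sequences of arbitrary bounded sets, up to an arbitrarily small
    loss in [e] ([cover_content_bigcup], [spherical_content_bigcup]).  This is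
    where the geometry is used.  A finite net of balls and the pigeonhole
    principle let one split off a fixed finite family of large balls
    shared by nearly optimal covers of all the sets of the sequence
    ([extract_large_sets]).  Iterating at smaller and smaller scales exhausts
    the large balls; what remains is covered at every scale with the remaining
    budget, so its Hausdorff measure is bounded by that budget, and a regular
    outer measure is continuous along increasing sequences
    ([regular_outer_bigcup]).  Regularity of [S^d] holds because balls are
    measurable by the metric criterion ([metric_caratheodory]). *)

(** * Regular outer measures and completions *)

Section regular_outer_measure.
Local Open Scope ereal_scope.
Context {R : realType} {T : pointedType}.
Implicit Type mu : {outer_measure set T -> \bar R}.

Definition regular_outer mu := forall A, exists B,
  [/\ A `<=` B, mu.-caratheodory B & mu B <= mu A].

(** Replace [F i] by a hull [G i] of the same measure: the sets
    [\bigcap_(j >= i) G j] are measurable, increase, contain [F i] and have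
    its measure, so continuity from below of a measure applies to them. *)
Lemma regular_outer_bigcup mu : regular_outer mu ->
  forall F : (set T)^nat, nondecreasing_seq F ->
  mu (\bigcup_i F i) <= ereal_sup (range (mu \o F)).
Proof.
move=> reg F ndF.
have /choice[G GP] : forall i, exists B,
  [/\ F i `<=` B, mu.-caratheodory B & mu B <= mu (F i)] by move=> i; exact: reg.
pose V i : set (caratheodory_type mu) := \bigcap_(j in [set j | (i <= j)%N]) G j.
have mV i : mu.-cara.-measurable (V i).
  by apply: bigcap_measurable => [|j _]; [exists i => /= | have [] := GP j].
have FV i : F i `<=` V i.
  move=> x Fx j /= ij; have [+ _ _] := GP j; apply.
  by move: x Fx; apply/subsetPset; exact: ndF.
have ndV : nondecreasing_seq V.
  by move=> i j ij; apply/subsetPset => x Vx k /= jk; apply: Vx => /=; exact: leq_trans jk.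
have cvgV : mu (V i) @[i --> \oo] --> mu (\bigcup_i V i).
  exact: (@nondecreasing_cvg_mu _ _ _ (mu : set (caratheodory_type mu) -> \bar R) V
    mV (bigcupT_measurable _ mV) ndV).
apply: (@le_trans _ _ (mu (\bigcup_i V i))).
  by apply: le_outer_measure; exact: subset_bigcup.
rewrite -(cvg_lim _ cvgV)//; apply: lime_le; first by apply/cvg_ex; eexists; exact: cvgV.
apply: nearW => i; apply: le_ereal_sup_tmp; exists (mu (F i)); first by exists i.
have [_ _] := GP i; apply: le_trans; apply: le_outer_measure => x; apply => /=.
exact: leqnn.
Qed.

End regular_outer_measure.

Section completion.
Local Open Scope ereal_scope.
Context d {T : measurableType d} {R : realType} (P : probability T R).

Let Pmu : {outer_measure set T -> \bar R} := (P^*)%mu.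

Lemma mu_ext_hull (A : set T) : exists B,
  [/\ A `<=` B, measurable B & P B <= (P^*)%mu A].
Proof.
have AP : (P^*)%mu A \is a fin_num.
  rewrite ge0_fin_numE; last exact: mu_ext_ge0.
  apply: (@le_lt_trans _ _ ((P^*)%mu setT)); first exact: le_mu_ext.
  by rewrite measurable_mu_extE//= -ge0_fin_numE ?fin_num_measure.
have /choice[B BP] : forall i : nat, exists B, [/\ A `<=` B, measurable B &
    P B <= (P^*)%mu A + i.+1%:R^-1%:E].
  move=> i; have := @lb_ereal_inf_adherent _
    [set \sum_(k <oo) P (F k) | F in measurable_cover A] i.+1%:R^-1.
  case=> // _ [F [mF AF] <-] h; exists (\bigcup_k F k); split => //.
    exact: bigcupT_measurable.
  apply: le_trans (ltW h).
  by apply: measure_sigma_subadditive => //; exact: bigcupT_measurable.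
exists (\bigcap_i B i); split.
- by move=> x Ax i _; have [+ _ _] := BP i; apply.
- by apply: bigcap_measurable => // i _; have [] := BP i.
- apply/lee_addgt0Pr => e e0.
  have [i ie] : exists i : nat, (i.+1%:R^-1 < e)%R.
    by near \oo => i; exists i; near: i; exact: near_infty_natSinv_lt (PosNum e0).
  have [_ mB BA] := BP i.
  apply: (@le_trans _ _ (P (B i))).
    apply: le_measure; rewrite ?inE//; last by move=> x; exact.
    by apply: bigcap_measurable => // j _; have [] := BP j.
  by rewrite (le_trans BA)// leeD2l// lee_fin ltW.
Unshelve. all: by end_near. Qed.

Lemma regular_mu_ext : regular_outer Pmu.
Proof.
move=> A; have [B [AB mB PB]] := mu_ext_hull A; exists B; split => //.
  by apply: sub_caratheodory; exact: sub_sigma_algebra.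
by rewrite /Pmu/= measurable_mu_extE.
Qed.

(** [B] lies between the complement of a hull of [~` B] and a hull of [B], and
    additivity on [B] makes the gap between these two a null set. *)
Lemma caratheodory_completed (B : set T) : Pmu.-caratheodory B ->
  completed_algebra_gen P B.
Proof.
move=> cB.
have [U [BU mU PU]] := mu_ext_hull B.
have [V [BV mV PV]] := mu_ext_hull (~` B).
exists (~` V); first exact: measurableC.
have WB : ~` V `<=` B by rewrite -(setCK B); exact: subsetC.
exists (B `\` ~` V); last by rewrite setDUK.
exists (U `\` ~` V); split; last by apply: setSD.
  by apply: measurableD => //; exact: measurableC.
rewrite setDE setCK.
have UV : U `|` V = setT.
  apply/seteqP; split => // x _; have [Bx|nBx] := pselect (B x).
    by left; exact: BU.
  by right; exact: BV.
have Pfin W : measurable W -> P W \is a fin_num by exact: fin_num_measure.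
have h1 : P U + P V <= 1.
  have <- : Pmu setT = 1 by rewrite /Pmu/= measurable_mu_extE//; exact: probability_setT.
  by rewrite (cB setT) !setTI; exact: leeD.
have h2 : P (U `|` V) + P (U `&` V) = P U + P V.
  have UVE : U `|` V = U `|` (V `\` U).
    apply/seteqP; split=> x; last by case=> [?|[? _]]; [left|right].
    by have [Ux|nUx] := pselect (U x); [left|case=> [?|?]; [left|right]].
  rewrite UVE measureU//; [|exact: measurableD|by rewrite setDE setIC -setIA setICl setI0].
  rewrite -addeA; congr (_ + _).
  rewrite setIC -measureU//; [|exact: measurableD|exact: measurableI|].
    by congr (P _); rewrite setDE -setIUr setUC setUCr setIT.
  by apply/seteqP; split => // x [[_ nU] [_ Ux]].
move: h2; rewrite UV probability_setT => h2; move: h1; rewrite -h2.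
rewrite -[leRHS]adde0 leeD2lE//.
move=> h; apply/eqP; rewrite eq_le measure_ge0 andbT; exact: h.
Qed.

(** The union of measurable subsets of [B] of probability tending to the outer
    probability of [B] differs from a hull of [B] by a null set. *)
Lemma inner_regular_caratheodory (B : set T) :
  (forall a : \bar R, a < Pmu B -> exists W, [/\ measurable W, W `<=` B & a <= P W]) ->
  Pmu.-caratheodory B.
Proof.
move=> H; have [U [BU mU PU]] := mu_ext_hull B.
have Bfin : Pmu B \is a fin_num.
  rewrite ge0_fin_numE ?outer_measure_ge0//.
  apply: (@le_lt_trans _ _ (P U)); last by rewrite -ge0_fin_numE ?fin_num_measure.
  by rewrite -(@measurable_mu_extE _ _ _ P)// le_outer_measure.
have /choice[W WP] : forall i : nat, exists W, [/\ measurable W, W `<=` B &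
    Pmu B - i.+1%:R^-1%:E <= P W].
  by move=> i; apply: H; rewrite lteBlDr// lteDl// lte_fin invr_gt0.
pose V := \bigcup_i W i.
have mV : measurable V by apply: bigcupT_measurable => i; have [] := WP i.
have VB : V `<=` B by move=> x [i _]; have [_ + _] := WP i; apply.
have UV0 : P (U `\` V) = 0.
  apply/eqP; rewrite eq_le measure_ge0 andbT; apply/lee_addgt0Pr => e e0.
  have [i ie] : exists i : nat, (i.+1%:R^-1 < e)%R.
    by near \oo => i; exists i; near: i; exact: near_infty_natSinv_lt (PosNum e0).
  have [mW WB BW] := WP i.
  apply: (@le_trans _ _ (P (U `\` W i))).
    apply: le_measure; rewrite ?inE//; [exact: measurableD|exact: measurableD|].
    by apply: setDS => x Wx; exists i.
  rewrite measureD//; last by rewrite -ge0_fin_numE ?fin_num_measure.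
  rewrite setIidr; last exact: subset_trans BU.
  rewrite add0e leeBlDr; last exact: fin_num_measure.
  apply: (le_trans PU); rewrite leeBlDr in BW => //.
  by apply: (le_trans BW); rewrite addeC leeD2r// lee_fin ltW.
apply: le_caratheodory_measurable => X.
rewrite (_ : Pmu X = Pmu (X `&` V) + Pmu (X `&` ~` V)); last first.
  by apply: sub_caratheodory; exact: sub_sigma_algebra.
apply: leeD; last by apply: le_outer_measure; apply: setIS; exact: subsetC.
apply: (@le_trans _ _ (Pmu ((X `&` V) `|` (U `\` V)))).
  apply: le_outer_measure => x [Xx Bx].
  have [Vx|nVx] := pselect (V x); first by left.
  by right; split => //; exact: BU.
apply: (le_trans (outer_measureU2 _ _ _)).
rewrite [X in _ + X](_ : _ = 0) ?adde0// /Pmu/= measurable_mu_extE//.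
exact: measurableD.
Unshelve. all: by end_near. Qed.

Lemma completion_measurableP (f : T -> \bar R) (c : \bar R) :
  (forall t : R, Pmu.-caratheodory [set y | t%:E < f y]) ->
  completion_measurable P (fun y => c * f y).
Proof.
move=> H Y mY; apply: caratheodory_completed.
have mf : measurable_fun setT (f : caratheodory_type Pmu -> \bar R).
  apply: (measurability _ (ErealGenOInfty.measurableE R)) => _ [_ [x ->] <-].
  rewrite setTI; have := H x; congr (_.-caratheodory _).
  by apply/seteqP; split => y /=; rewrite in_itv/= andbT.
have mcf : measurable_fun setT ((fun y => c * f y) : caratheodory_type Pmu -> \bar R).
  exact: measurable_funeM.
by have := mcf measurableT _ mY; rewrite setTI.
Qed.

End completion.

(** * Countable covers and the measures they generate *)

Section cover_content.
Local Open Scope ereal_scope.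
Context {R : realType} {T : Type} {I : pointedType} (U : I -> set T) (w : I -> R).
Hypothesis w_ge0 : forall i, (0 <= w i)%R.
Implicit Types (adm : set I) (A : set T).

(** Caratheodory's first construction: [U] is a family of covering sets with
    weights [w], of which only those with index in [adm] are used.  The covers
    are indexed by subsets of [nat], to allow finite and empty ones. *)
Definition cover_content adm A : \bar R :=
  ereal_inf [set v | exists (D : set nat) (b : nat -> I),
    [/\ forall i, D i -> adm (b i), A `<=` \bigcup_(i in D) U (b i) &
        v = \esum_(i in D) (w (b i))%:E]].

Lemma cover_content_ge0 adm A : 0 <= cover_content adm A.
Proof.
by apply: le_ereal_inf_tmp => _ [D [b [_ _ ->]]]; apply: esum_ge0 => i _; rewrite lee_fin.
Qed.

Lemma le_cover_content adm adm' A A' : adm' `<=` adm -> A `<=` A' ->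
  cover_content adm A <= cover_content adm' A'.
Proof.
move=> aa AA; apply: ereal_inf_le_tmp => _ [D [b [Db Ab ->]]].
by exists D, b; split => //; [move=> i /Db /aa | exact: subset_trans Ab].
Qed.

Lemma cover_content_lb {J : countType} (D : set J) (b : J -> I) adm A :
  (forall j, D j -> adm (b j)) -> A `<=` \bigcup_(j in D) U (b j) ->
  cover_content adm A <= \esum_(j in D) (w (b j))%:E.
Proof.
move=> Db Ab.
pose b' n := if unpickle n is Some j then b j else point.
have bE j : b' (pickle j) = b j by rewrite /b' pickleK.
apply: ereal_inf_lbound; exists (pickle @` D), b'; split.
- by move=> _ [j Dj <-]; rewrite bE; exact: Db.
- by move=> x /Ab [j Dj Ux]; exists (pickle j); [exists j | rewrite bE].
- rewrite esum_image; first by apply: eq_esum => j _; rewrite bE.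
  by move=> i j _ _; exact: (pcan_inj pickleK).
Qed.

Lemma cover_content_seq (s : seq I) adm A : {in s, forall i, adm i} ->
  A `<=` [set x | exists2 i, i \in s & U i x] ->
  cover_content adm A <= (\sum_(i <- s) w i)%:E.
Proof.
move=> sa As; rewrite (big_nth point) big_mkord -sumEFin.
rewrite (fsbig_ord _ _ (fun j => (w (nth point s j))%:E)) -esum_fset; first last.
- by move=> i _; rewrite lee_fin.
- exact: finite_II.
- apply: cover_content_lb => [j /= js|]; first by apply: sa; rewrite mem_nth.
  by move=> x /As [i /(nthP point) [j js <-] Ux]; exists j.
Qed.

Lemma cover_content_lt adm A (t : \bar R) : cover_content adm A < t ->
  exists (D : set nat) (b : nat -> I),
    [/\ forall i, D i -> adm (b i), A `<=` \bigcup_(i in D) U (b i) &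
        \esum_(i in D) (w (b i))%:E < t].
Proof.
by move=> /ereal_inf_lt [_ [D [b [Db Ab ->]]]] ?; exists D, b.
Qed.

Lemma cover_content_sigma_subadditive adm : sigma_subadditive (cover_content adm).
Proof.
move=> A; have [[i ioo]|] := pselect (exists i, cover_content adm (A i) = +oo).
  rewrite (eseries_pinfty _ _ ioo) ?leey// => n _.
  by rewrite -ltNye (lt_le_trans _ (cover_content_ge0 _ _)).
rewrite -forallNE => Aoo; apply/lee_addgt0Pr => e e0.
rewrite (le_trans _ (epsilon_trick _ _ (ltW e0)))//; last first.
  by move=> n; exact: cover_content_ge0.
have /choice[F FP] : forall n, exists Db : set nat * (nat -> I),
    [/\ forall i, Db.1 i -> adm (Db.2 i),
      A n `<=` \bigcup_(i in Db.1) U (Db.2 i) &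
      \esum_(i in Db.1) (w (Db.2 i))%:E <=
        cover_content adm (A n) + (e / (2 ^ n.+1)%:R)%:E].
  move=> n; have : cover_content adm (A n) <
      cover_content adm (A n) + (e / (2 ^ n.+1)%:R)%:E.
    rewrite lteDl// ?lte_fin ?divr_gt0// ?ltr0n ?expn_gt0//.
    by rewrite ge0_fin_numE ?cover_content_ge0// ltey; apply/eqP.
  by move=> /cover_content_lt [D [b [? ? h]]]; exists (D, b); split => //; exact: ltW.
pose D' := [set nm : nat * nat | (F nm.1).1 nm.2].
pose b' (nm : nat * nat) := (F nm.1).2 nm.2.
apply: (@le_trans _ _ (\esum_(j in D') (w (b' j))%:E)).
  apply: cover_content_lb => [[n m] /= nm|x [n _ /=]].
    by have [+ _ _] := FP n; exact.
  by have [_ + _] := FP n => /[apply] -[m Dm Ux]; exists (n, m).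
rewrite (_ : D' = setT `*`` (fun n => (F n).1)); last first.
  by apply/seteqP; split => -[n m] /=; [split|case].
rewrite -(@esum_esum _ _ _ setT (fun n => (F n).1) (fun n m => (w (b' (n, m)))%:E))//; last first.
  by move=> *; rewrite lee_fin.
rewrite -nneseries_esumT; last by move=> n; apply: esum_ge0 => *; rewrite lee_fin.
apply: lee_nneseries => [n _ _|n _ /=]; first by apply: esum_ge0 => *; rewrite lee_fin.
by have [] := FP n.
Qed.

Lemma cover_content0 adm : cover_content adm set0 = 0.
Proof.
apply/eqP; rewrite eq_le cover_content_ge0 andbT.
by rewrite -(@esum_set0 _ _ (fun j : nat => (w point)%:E)); exact: cover_content_lb.
Qed.

Definition cover_outer_measure adm : {outer_measure set T -> \bar R} :=
  HB.pack (cover_content adm) (isOuterMeasure.Build R T (cover_content adm)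
    (cover_content0 adm) (cover_content_ge0 adm)
    (fun A B => @le_cover_content adm adm A B (@subset_refl _ adm))
    (cover_content_sigma_subadditive adm)).

Lemma cover_contentU2 adm A B :
  cover_content adm (A `|` B) <= cover_content adm A + cover_content adm B.
Proof. exact: (outer_measureU2 (cover_outer_measure adm)). Qed.

End cover_content.

Section hausdorff_content.
Local Open Scope ereal_scope.
Context {R : realType} {T : pointedType} {I : pointedType} (U : I -> set T) (w : I -> R).
Hypothesis w_ge0 : forall i, (0 <= w i)%R.
Variable adm : R -> set I.
Hypothesis le_adm : forall e e', (e <= e')%R -> adm e `<=` adm e'.

Local Notation h e := (cover_content U w (adm e)).

(** Caratheodory's second construction, over a decreasing family [adm e] of
    admissible indices as [e] tends to [0]. *)
Definition hausdorff_content (A : set T) : \bar R :=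
  ereal_sup [set h e A | e in [set e : R | (0 < e)%R]].

Local Notation H := hausdorff_content.

Lemma cover_content_le_hausdorff e A : (0 < e)%R -> h e A <= H A.
Proof. by move=> e0; apply: ereal_sup_ubound; exists e. Qed.

Lemma hausdorff_content_ge0 A : 0 <= H A.
Proof.
by apply: le_trans (cover_content_le_hausdorff A ltr01); exact: cover_content_ge0.
Qed.

Lemma hausdorff_content0 : H set0 = 0.
Proof.
apply/eqP; rewrite eq_le hausdorff_content_ge0 andbT.
by apply: ge_ereal_sup => _ [e _ <-]; rewrite cover_content0.
Qed.

Lemma le_hausdorff_content : {homo H : A B / A `<=` B >-> A <= B}.
Proof.
move=> A B AB; apply: ge_ereal_sup => _ [e e0 <-].
by apply: le_trans (cover_content_le_hausdorff B e0); exact: le_cover_content.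
Qed.

Lemma hausdorff_content_sigma_subadditive : sigma_subadditive H.
Proof.
move=> A; apply: ge_ereal_sup => _ [e e0 <-].
apply: (@le_trans _ _ (\sum_(0 <= i <oo) h e (A i))).
  exact: cover_content_sigma_subadditive.
apply: lee_nneseries => [i _ _|i _]; first exact: cover_content_ge0.
exact: cover_content_le_hausdorff.
Qed.

Definition hausdorff_outer_measure : {outer_measure set T -> \bar R} :=
  HB.pack H (isOuterMeasure.Build R T H hausdorff_content0 hausdorff_content_ge0
    le_hausdorff_content hausdorff_content_sigma_subadditive).

(** At scales below [e] no covering set meets both [A] and [B], so a cover of
    the union splits into two disjoint subfamilies. *)
Lemma hausdorff_content_separated A B e : (0 < e)%R ->
  (forall p, adm e p -> U p `&` A !=set0 -> U p `&` B !=set0 -> False) ->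
  H A + H B <= H (A `|` B).
Proof.
move=> e0 sep.
have [->|Xoo] := eqVneq (H (A `|` B)) +oo; first by rewrite leey.
have fin C : C `<=` A `|` B -> H C \is a fin_num.
  move=> CX; rewrite ge0_fin_numE ?hausdorff_content_ge0//.
  by rewrite (le_lt_trans (le_hausdorff_content CX))// ltey.
have hfin a C : (0 < a)%R -> C `<=` A `|` B -> h a C \is a fin_num.
  move=> a0 CX; rewrite ge0_fin_numE ?cover_content_ge0//.
  rewrite (le_lt_trans (cover_content_le_hausdorff C a0))//.
  by rewrite -ge0_fin_numE ?hausdorff_content_ge0// fin.
rewrite -leeBrDr ?fin//; apply: ge_ereal_sup => _ [a /= a0 <-].
rewrite leeBrDr ?fin// -leeBrDl ?hfin//.
apply: ge_ereal_sup => _ [b /= b0 <-]; rewrite leeBrDl ?hfin//.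
pose m := Num.min e (Num.min a b).
have m0 : (0 < m)%R by rewrite !lt_min e0 a0.
have ma : (m <= a)%R by rewrite !ge_min lexx orbT.
have mb : (m <= b)%R by rewrite !ge_min lexx !orbT.
have me : (m <= e)%R by rewrite !ge_min lexx.
apply: (@le_trans _ _ (h m A + h m B)).
  by apply: leeD; apply: le_cover_content => //; exact: le_adm.
apply: (@le_trans _ _ (h m (A `|` B))); last exact: cover_content_le_hausdorff.
apply: le_ereal_inf_tmp => _ [D [c [Dc ABc ->]]].
pose DA := D `&` [set j | U (c j) `&` A !=set0].
pose DB := D `&` ~` [set j | U (c j) `&` A !=set0].
rewrite (esumID [set j | U (c j) `&` A !=set0]); last by move=> *; rewrite lee_fin.
apply: leeD.
  apply: cover_content_lb => [j [/Dc]//|x Ax].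
  by have [j Dj Ux] := ABc x (or_introl Ax); exists j => //; split=> //; exists x.
apply: cover_content_lb => [j [/Dc]//|x Bx].
have [j Dj Ux] := ABc x (or_intror Bx); exists j => //; split=> //= Aj.
by apply: (sep (c j) _ Aj); [apply: (le_adm me); exact: Dc | exists x].
Qed.

(** The hull is the intersection of the unions of nearly optimal covers at the
    scales [1 / n.+1]. *)
Lemma hausdorff_outer_measure_regular :
  (forall p, hausdorff_outer_measure.-caratheodory (U p)) ->
  regular_outer hausdorff_outer_measure.
Proof.
move=> cU A.
have [Aoo|Aoo] := eqVneq (H A) +oo.
  exists setT; split => //=; last by rewrite Aoo leey.
  rewrite -setC0; apply: (@caratheodory_measurable_setC _ _ hausdorff_outer_measure).
  exact: (@caratheodory_measurable_set0 _ _ hausdorff_outer_measure).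
have HA : H A \is a fin_num by rewrite ge0_fin_numE ?hausdorff_content_ge0// ltey.
have e0 (n : nat) : (0 < n.+1%:R^-1 :> R)%R by rewrite invr_gt0.
have /choice[F FP] : forall n : nat, exists Db : set nat * (nat -> I),
    [/\ forall i, Db.1 i -> adm n.+1%:R^-1 (Db.2 i),
      A `<=` \bigcup_(i in Db.1) U (Db.2 i) &
      \esum_(i in Db.1) (w (Db.2 i))%:E < H A + n.+1%:R^-1%:E].
  move=> n; have : h n.+1%:R^-1 A < H A + n.+1%:R^-1%:E.
    apply: le_lt_trans (cover_content_le_hausdorff A (e0 n)) _.
    by rewrite lteDl// lte_fin.
  by move=> /cover_content_lt [D [b [? ? ?]]]; exists (D, b).
pose V n := \bigcup_(i in (F n).1) U ((F n).2 i).
have cV n : hausdorff_outer_measure.-caratheodory (V n).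
  rewrite /V bigcup_mkcond; apply: caratheodory_measurable_bigcup => i.
  by case: ifP => _; [exact: cU | exact: caratheodory_measurable_set0].
exists (\bigcap_n V n); split.
- by move=> x Ax n _; have [_ + _] := FP n; exact.
- rewrite -[X in _.-caratheodory X]setCK setC_bigcap.
  apply: caratheodory_measurable_setC; apply: caratheodory_measurable_bigcup => n.
  exact: caratheodory_measurable_setC.
- apply: ge_ereal_sup => _ [e /= ep <-]; apply/lee_addgt0Pr => eps eps0.
  near \oo => n.
  have ne : (n.+1%:R^-1 <= e)%R.
    by apply: ltW; near: n; exact: near_infty_natSinv_lt (PosNum ep).
  have neps : (n.+1%:R^-1 <= eps)%R.
    by apply: ltW; near: n; exact: near_infty_natSinv_lt (PosNum eps0).
  have [Fadm _ Flt] := FP n.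
  apply: (@le_trans _ _ (\esum_(i in (F n).1) (w ((F n).2 i))%:E)).
    apply: cover_content_lb => [j /Fadm|]; first exact: le_adm.
    by move=> x; exact.
  by apply: le_trans (ltW Flt) _; rewrite leeD2l// lee_fin.
Unshelve. all: by end_near. Qed.

End hausdorff_content.

(** * The metric criterion for measurability *)

Section metric_outer_measure.
Local Open Scope ereal_scope.
Context {R : realType} {T : Type} (mu : {outer_measure set T -> \bar R}) (f : T -> R).
Hypothesis mu_sep : forall (A B : set T) (delta : R), (0 < delta)%R ->
  (forall x y, A x -> B y -> (f y + delta <= f x)%R) -> mu A + mu B <= mu (A `|` B).

(** Caratheodory's criterion, for a positivity set [{f > 0}] instead of a
    general open set.  The sets [A j = {f >= 1 / j.+1}] are separated from
    [{f <= 0}], so it is enough that [mu (A j)] tends to [mu {f > 0}] inside a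
    set of finite measure.  As [A j] is also separated from the layer [S j.+1],
    the measures of the layers are dominated by a telescoping sum; their series
    converges, and its tail bounds [mu {f > 0} - mu (A j)]. *)
Lemma metric_caratheodory : mu.-caratheodory [set x | (0 < f x)%R].
Proof.
apply: le_caratheodory_measurable => X.
have [->|Xoo] := eqVneq (mu X) +oo; first by rewrite leey.
have fin B : B `<=` X -> mu B \is a fin_num.
  move=> BX; rewrite ge0_fin_numE ?outer_measure_ge0//.
  by rewrite (le_lt_trans (le_outer_measure mu _ _ BX))// ltey.
pose A j := X `&` [set x | (j.+1%:R^-1 <= f x)%R].
pose S j := X `&` [set x | (j.+2%:R^-1 <= f x < j.+1%:R^-1)%R].
have AX j : A j `<=` X by move=> x [].
have SX j : S j `<=` X by move=> x [].
have invle i j : (i <= j)%N -> (j.+1%:R^-1 <= i.+1%:R^-1 :> R)%R.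
  by move=> ij; rewrite lef_pV2 ?posrE ?ltr0n// ler_nat.
have invlt i : (i.+2%:R^-1 < i.+1%:R^-1 :> R)%R.
  by rewrite ltf_pV2 ?posrE ?ltr0n// ltr_nat.
pose g j := fine (mu (A j)).
have gE j : mu (A j) = (g j)%:E by rewrite fineK ?fin.
have g_nd i j : (i <= j)%N -> (g i <= g j)%R.
  move=> ij; rewrite -lee_fin -!gE; apply: le_outer_measure => x [Xx /= fx].
  by split => //=; rewrite (le_trans (invle _ _ ij)).
have gX j : (g j)%:E <= mu X by rewrite -gE; exact: le_outer_measure.
pose s j := fine (mu (S j)).
have sE j : mu (S j) = (s j)%:E by rewrite fineK ?fin.
(* the layers of index at least j+1 lie strictly below A j *)
have sg j : (s j.+1 <= g j.+2 - g j)%R.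
  rewrite lerBrDl -lee_fin EFinD -gE -sE.
  have := @mu_sep (A j) (S j.+1) (j.+1%:R^-1 - j.+2%:R^-1) _ _.
  rewrite subr_gt0 invlt => /(_ isT); rewrite /A /S => h.
  apply: le_trans (h _) _.
    move=> x y [_ /= fx] [_ /= /andP[_ fy]]; rewrite (le_trans _ fx)//.
    by rewrite addrCA gerDl subr_le0 ltW.
  rewrite -gE; apply: le_outer_measure => x [[Xx fx]|[Xx /andP[fx _]]]; split => //=.
  by rewrite (le_trans _ fx)//; apply: invle; exact: leqW (leqnSn _).
have sum_s j n : (\sum_(j <= i < (j + n)%N) s i.+1 <=
    g (j + n)%N.+1 + g (j + n)%N - g j.+1 - g j)%R.
  elim: n => [|n ih]; first by rewrite addn0 big_geq//; lra.
  by rewrite addnS big_nat_recr ?leq_addr//=; have := sg (j + n)%N; lra.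
set m := fine (mu X).
have mE : mu X = m%:E by rewrite fineK ?fin.
have gm j : (g j <= m)%R by rewrite -lee_fin -mE.
pose G := sup (range g).
have supG : has_sup (range g).
  by split; [exists (g 0%N); exists 0%N | exists m => _ [j _ <-]].
have gG j : (g j <= G)%R by apply: ub_le_sup; [case: supG | exists j].
set B := X `&` _; set N := X `&` _.
have NA j : mu N + mu (A j) <= mu X.
  rewrite addeC; apply: (@le_trans _ _ (mu (A j `|` N))); last first.
    by apply: le_outer_measure => x [|] [].
  apply: (@mu_sep _ _ j.+1%:R^-1); first by rewrite invr_gt0.
  by move=> x y [_ /= fx] [_ /negP]; rewrite -leNgt => fy; rewrite (le_trans _ fx)// gerDr.
have NG : mu N + G%:E <= mu X.
  rewrite -leeBrDl ?fin//; last by move=> x [].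
  rewrite mE -(@fineK _ (mu N)) ?fin//; last by move=> x [].
  rewrite -EFinB lee_fin; apply: ge_sup; first by case: supG.
  move=> _ [j _ <-]; rewrite lerBrDl -lee_fin EFinD -mE -gE fineK ?NA// fin//.
  by move=> x [].
rewrite addeC; apply/lee_addgt0Pr => e e0.
apply: (@le_trans _ _ (mu N + G%:E + e%:E)); last by rewrite leeD2r.
rewrite -addeA leeD2l//.
have [_ [j _ <-] gj] : exists2 x, range g x & (G - e / 2 < x)%R.
  by apply: sup_adherent => //; rewrite divr_gt0.
apply: (@le_trans _ _ (mu (A j.+1) + \sum_(i <oo) mu (S (i + j)%N.+1))).
  apply: (@le_trans _ _ (mu (A j.+1 `|` \bigcup_i S (i + j)%N.+1))).
    apply: le_outer_measure => x [Xx /= fx].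
    have [fj|fj] := leP j.+2%:R^-1%R (f x); first by left.
    have exn : exists n : nat, (n.+1%:R^-1 <= f x)%R.
      by near \oo => n; exists n; apply: ltW; near: n; exact: near_infty_natSinv_lt (PosNum fx).
    right; case: (ex_minnP exn) => p px minp.
    have jp : (j.+2 <= p)%N.
      rewrite ltnNge; apply/negP => pj; move: fj; rewrite ltNge => /negP; apply.
      by rewrite (le_trans _ px)//; exact: invle pj.
    exists (p - j.+2)%N => //; rewrite /S.
    have -> : ((p - j.+2 + j).+1 = p.-1)%N by lia.
    case: p px minp jp => // p px minp jp /=; split => //=; rewrite px/= ltNge.
    by apply/negP => /minp; rewrite ltnn.
  apply: (le_trans (outer_measureU2 _ _ _)); rewrite leeD2l//.
  exact: outer_measure_sigma_subadditive.
rewrite gE.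
have -> : G%:E + e%:E = (g j.+1)%:E + (G + e - g j.+1)%:E by rewrite -!EFinD; congr _%:E; ring.
rewrite leeD2l//; apply: lime_le.
  by apply: is_cvg_nneseries => i _ _; exact: outer_measure_ge0.
apply: nearW => n.
rewrite (eq_bigr (fun i => (s (i + j)%N.+1)%:E)) => [|i _]; last exact: sE.
rewrite sumEFin lee_fin.
have := sum_s j n.
have -> : (\sum_(j <= i < (j + n)%N) s i.+1 = \sum_(0 <= i < n) s (i + j)%N.+1)%R.
  by rewrite -{1}(add0n j) big_addn addKn.
have := gG (j + n)%N.+1; have := gG (j + n)%N; have := g_nd j j.+1 (leqnSn _); lra.
Unshelve. all: by end_near. Qed.

End metric_outer_measure.

(** * Contents of increasing unions *)

(** If each stage [i] is served by one of finitely many [t], and serving a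
    stage implies serving the earlier ones, then one [t] serves all stages. *)
Lemma finite_pigeonhole (F : finType) (Q : F -> nat -> Prop) :
  (forall t i j, (i <= j)%N -> Q t j -> Q t i) ->
  (forall i, exists t, Q t i) -> exists t, forall i, Q t i.
Proof.
move=> Qanti QE; apply: contrapT => /forallNP nQ.
have /choice[g gP] : forall t, exists i, ~ Q t i by move=> t; exact/existsNP.
have [t Qt] := QE (\max_(t : F) g t).
by apply: (gP t); apply: Qanti Qt; exact: leq_bigmax.
Qed.

Lemma subset_esum {R : realType} {J : choiceType} (A B : set J) (a : J -> \bar R) :
  A `<=` B -> (forall j, (0 <= a j)%E) -> (\esum_(j in A) a j <= \esum_(j in B) a j)%E.
Proof.
move=> AB a0; rewrite [leRHS](esumID A)// setIidr// leeDl//.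
exact: esum_ge0.
Qed.

Section increasing_sets.
Local Open Scope ereal_scope.
Context {R : realType} {T I : pointedType} (U : I -> set T) (w : I -> R).
Hypothesis w_ge0 : forall i, (0 <= w i)%R.
Variables (adm : R -> set I) (C : set T).
Hypothesis le_adm : forall e e', (e <= e')%R -> adm e `<=` adm e'.
(* [w_lb] makes the large sets of a cover of finite total weight finite in
   number, and [net] replaces those that meet [C] by members of a finite
   family, at an arbitrarily small cost. *)
Hypothesis w_lb : forall e eta : R, (0 < eta)%R -> exists2 w0 : R, (0 < w0)%R &
  forall p, adm e p -> ~ adm eta p -> (w0 <= w p)%R.
Hypothesis net : forall e e' eta e0 : R, (0 < eta)%R -> (e < e')%R -> (0 < e0)%R ->
  exists N : seq I, {in N, forall q, adm e' q} /\
    forall p, adm e p -> ~ adm eta p -> U p `&` C !=set0 ->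
      exists2 q, q \in N & U p `<=` U q /\ (w q <= w p + e0)%R.

Local Notation h e := (cover_content U w (adm e)).
Local Notation cover s := [set x | exists2 i, i \in s & U i x].

(** For each [i], round the large sets of a nearly optimal cover of [E i] to a
    finite net.  Their number is bounded independently of [i], so finitely many
    families [s] can occur, and having the stated property for [E j] implies
    having it for the smaller sets [E i], [i <= j]: one family serves every
    [i] by [finite_pigeonhole].  The sum of the two terms, rather than the
    content alone, is controlled so that the step can be iterated without
    spending the budget [L] twice. *)
Lemma extract_large_sets (E : (set T)^nat) (L e e' eta eps : R) :
  nondecreasing_seq E -> (forall i, E i `<=` C) ->
  (e < e')%R -> (0 < eta)%R -> (0 < eps)%R ->
  (forall i, h e (E i) <= L%:E) ->
  exists s : seq I, {in s, forall q, adm e' q} /\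
    forall i, h eta (E i `\` cover s) + (\sum_(q <- s) w q)%:E <= (L + eps)%:E.
Proof.
move=> ndE EC ee eta0 eps0 hE.
have [w0 w00 wlb] := w_lb e eta0.
have [M ML] : exists M : nat, (L + eps < M%:R * w0)%R.
  have [M hM] : exists M : nat, ((L + eps) / w0 < M%:R)%R.
    by exists (Num.truncn `|(L + eps) / w0|%R).+1; rewrite (le_lt_trans (ler_norm _))// truncnS_gt.
  by exists M; rewrite -ltr_pdivrMr.
(* At most [M] large sets get rounded: half of [eps] pays for the rounding, the
   other half for the cover. *)
pose e0 := (eps / 2 / M.+1%:R)%R.
have e00 : (0 < e0)%R by rewrite /e0 !divr_gt0// ltr0n.
have [N [Nadm netN]] := @net e e' eta e0 eta0 ee e00.
pose sq (t : {bseq M of 'I_(size N).+1}) := [seq nth point N (k : 'I__) | k <- t].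
pose Q t i := {in sq t, forall q, adm e' q} /\
    h eta (E i `\` cover (sq t)) + (\sum_(q <- sq t) w q)%:E <= (L + eps)%:E.
suff [t Qt] : exists t, forall i, Q t i.
  by exists (sq t); split; [have [] := Qt 0%N | move=> i; have [] := Qt i].
apply: finite_pigeonhole.
  move=> t i j ij [? hj]; split => //; apply: le_trans hj; rewrite leeD2r//.
  by apply: le_cover_content => //; apply: setSD; apply/subsetPset/ndE.
move=> i.
have : h e (E i) < (L + eps / 2)%:E.
  by rewrite (le_lt_trans (hE i))// lte_fin ltrDl divr_gt0.
move=> /cover_content_lt [D [b [Db Eb Lb]]].
pose Big := D `&` [set j | ~ adm eta (b j) /\ U (b j) `&` C !=set0].
have wb0 j : 0 <= (w (b j))%:E by rewrite lee_fin.
have Bcard (X : seq nat) : uniq X -> [set` X] `<=` Big -> (size X < M)%N.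
  move=> uX XB; rewrite ltnNge; apply/negP => MX.
  suff : (M%:R * w0 <= L + eps / 2)%R.
    move=> hh; have := lt_le_trans ML hh; rewrite ltrD2l.
    by rewrite ltNge ler_piMr ?ltW// invf_lt1 ?ltr1n.
  rewrite -lee_fin; apply: le_trans (ltW Lb).
  apply: esum_ge; exists [set` X].
    by split; [exact: finite_seq | move=> j /XB []].
  rewrite -fsbig_seq//.
  apply: (@le_trans _ _ (\sum_(j <- X) w0%:E)).
    rewrite sumEFin lee_fin big_const_seq count_predT iter_addr_0 -[leRHS]mulr_natl.
    by rewrite ler_wpM2r ?ler_nat// ltW.
  rewrite !sumEFin lee_fin big_seq [leRHS]big_seq; apply: ler_sum => j jX.
  by have [Dj []] := XB j jX; move=> ? _; apply: wlb => //; exact: Db.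
have finB : finite_set Big.
  apply: contrapT => /(infinite_set_fset M) [X XB]; apply/negP; rewrite -ltnNge.
  by apply: Bcard => //; exact: finmap.fset_uniq.
have /choice[f fP] : forall j, exists k : nat, Big j ->
   [/\ (k < size N)%N, U (b j) `<=` U (nth point N k) & (w (nth point N k) <= w (b j) + e0)%R].
  move=> j; have [Bj|nBj] := pselect (Big j); last by exists 0%N.
  have [|q /(nthP point)[k kN <-] [? ?]] := netN (b j) _ Bj.2.1 Bj.2.2; first exact: Db Bj.1.
  by exists k.
have [B [uB BE]] : exists B : seq nat, uniq B /\ Big = [set` B].
  have /finite_seqP[B0 BE] := finB; exists (undup B0); split; first exact: undup_uniq.
  by rewrite BE; apply/seteqP; split => j /=; rewrite mem_undup.
have BP j : j \in B -> Big j by rewrite BE.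
have BM : (size [seq (inord (f j) : 'I_(size N).+1) | j <- B] <= M)%N.
  by rewrite size_map ltnW// Bcard// => j /=; exact: BP.
exists (Bseq BM); rewrite /Q.
have sqE : sq (Bseq BM) = [seq nth point N (f j) | j <- B].
  rewrite /sq/= -map_comp; apply/eq_in_map => j jB /=.
  by rewrite inordK// ltnW// ltnS; have [] := fP j (BP j jB).
rewrite sqE; split.
  by move=> _ /mapP[j jB ->]; apply: Nadm; rewrite mem_nth//; have [] := fP j (BP j jB).
pose D' := D `&` [set j | adm eta (b j)].
have h1 : h eta (E i `\` cover [seq nth point N (f j) | j <- B]) <=
    \esum_(j in D') (w (b j))%:E.
  apply: cover_content_lb => [j []//|x [Ex nx]].
  have [j Dj Ux] := Eb x Ex.
  have [aj|naj] := pselect (adm eta (b j)); first by exists j.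
  have Bj : Big j by split=> //; split => //; exists x; split => //; exact: EC Ex.
  exfalso; apply: nx; exists (nth point N (f j)).
    by apply: map_f; rewrite BE in Bj.
  by have [_ + _] := fP j Bj; exact.
have h2 : (\sum_(q <- [seq nth point N (f j) | j <- B]) w q)%:E <=
    \esum_(j in Big) (w (b j))%:E + (eps / 2)%:E.
  rewrite esum_fset// BE -fsbig_seq// sumEFin -EFinD lee_fin big_map.
  apply: (@le_trans _ _ (\sum_(j <- B) (w (b j) + e0))%R).
    by rewrite big_seq [leRHS]big_seq; apply: ler_sum => j jB; have [] := fP j (BP j jB).
  rewrite big_split/= lerD2l big_const_seq count_predT iter_addr_0 -[leLHS]mulr_natl.
  rewrite /e0 mulrA ler_pdivrMr ?ltr0n// mulrC ler_pM2l ?divr_gt0//.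
  by rewrite ler_nat leqW//; move: (BM); rewrite size_map.
apply: (le_trans (leeD h1 h2)); rewrite addeA.
apply: (@le_trans _ _ ((L + eps / 2)%:E + (eps / 2)%:E)).
  rewrite leeD2r//; apply: le_trans (ltW Lb).
  rewrite [leRHS](esumID [set j | adm eta (b j)])//.
  by rewrite leeD2l//; apply: subset_esum => // j [Dj []].
by rewrite -EFinD -addrA -splitr.
Qed.

Local Notation hausdorff := (hausdorff_content U w adm).

Hypothesis hausdorff_bigcup : forall F : (set T)^nat, nondecreasing_seq F ->
  hausdorff (\bigcup_i F i) <= ereal_sup (range (hausdorff \o F)).

(** Increasing sets lemma.  Large sets are extracted at the scales
    [e / 2 ^ p], with errors summing to [eps].  Let [W] be the total weight
    extracted and [Z] the union of the extracted sets.  Outside [Z] every [E i]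
    has content at most [L + eps - W] at all scales, hence Hausdorff measure at
    most that; continuity from below of the Hausdorff measure gives the
    same bound for the union of the [E i], and [Z] costs [W]. *)
Lemma cover_content_bigcup (E : (set T)^nat) (e e' : R) :
  nondecreasing_seq E -> (forall i, E i `<=` C) -> (0 < e)%R -> (e < e')%R ->
  h e' (\bigcup_i E i) <= ereal_sup (range (fun i => h e (E i))).
Proof.
move=> ndE EC e0 ee.
have h0 a A : 0 <= h a A by exact: cover_content_ge0.
set L := ereal_sup _; have hL i : h e (E i) <= L.
  by apply: ereal_sup_ubound; exists i.
move: hL; case: L => [L hL| |hL]; last 2 first.
- by rewrite leey.
- by have := le_trans (h0 _ _) (hL 0%N).
apply/lee_addgt0Pr => eps eps0; rewrite -EFinD.
pose ep p : R := (e / 2 ^+ p)%R.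
have ep0 p : (0 < ep p)%R by rewrite divr_gt0// exprn_gt0.
have ep_le p q : (p <= q)%N -> (ep q <= ep p)%R.
  move=> pq; rewrite ler_pM2l// lef_pV2 ?posrE ?exprn_gt0//.
  by rewrite ler_eXn2l// ltr1n.
have epe p : (ep p < e')%R.
  by apply: le_lt_trans ee; have := ep_le 0%N p (leq0n _); rewrite {2}/ep expr0 divr1.
pose B p : R := (L + eps * (1 - 2 ^- p))%R.
have BL p : (B p <= L + eps)%R.
  by rewrite lerD2l ler_piMr ?(ltW eps0)// gerBl invr_ge0 exprn_ge0.
pose Inv p (S : seq I) := forall i, h (ep p) (E i `\` cover S) + (\sum_(q <- S) w q)%:E <= (B p)%:E.
have step p S : exists s, Inv p S -> {in s, forall q, adm e' q} /\ Inv p.+1 (S ++ s).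
  have [IS|nIS] := pselect (Inv p S); last by exists [::] => /nIS.
  have eta0 := ep0 p.+1.
  have pos : (0 < eps * 2 ^- p.+1)%R by rewrite mulr_gt0// invr_gt0 exprn_gt0.
  have [|||s [sadm hs]] := @extract_large_sets
    (fun i => E i `\` cover S) (B p - \sum_(q <- S) w q)%R (ep p) e' (ep p.+1) _
    _ _ (epe p) eta0 pos.
  - by move=> i j ij; apply/subsetPset; apply: setSD; apply/subsetPset/ndE.
  - by move=> i x [/EC].
  - by move=> i; rewrite EFinB leeBrDr.
  exists s => _; split => // i.
  have := hs i; rewrite setDDl (_ : cover S `|` cover s = cover (S ++ s)); last first.
    apply/seteqP; split => x /=.
      by case=> -[k ks Ux]; exists k => //; rewrite mem_cat ks ?orbT.
    by case=> k; rewrite mem_cat => /orP[ks|ks] Ux; [left|right]; exists k.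
  rewrite big_cat/= => hsi.
  rewrite EFinD addeA (addeAC _ (_%:E)) -leeBrDr// -EFinB.
  apply: (le_trans hsi); rewrite lee_fin /B !exprS.
  rewrite le_eqVlt; apply/orP; left; apply/eqP.
  by field; rewrite expf_neq0.
pose g p S := projT1 (cid (step p S)).
have gP p S : Inv p S -> {in g p S, forall q, adm e' q} /\ Inv p.+1 (S ++ g p S).
  by rewrite /g; case: cid.
pose S := fix S p := if p is p'.+1 then S p' ++ g p' (S p') else [::].
have InvS p : Inv p (S p).
  elim: p => [|p ih] /=; last by have [] := gP _ _ ih.
  move=> i; rewrite big_nil adde0 /B expr0 invr1 subrr mulr0 addr0 /ep expr0 divr1.
  by apply: le_trans (hL i); apply: le_cover_content => // x [].
pose s p := g p (S p).
have sadm p : {in s p, forall q, adm e' q} by have [] := gP _ _ (InvS p).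
have SE p : (\sum_(q <- S p) w q)%:E = \sum_(0 <= k < p) (\sum_(q <- s k) w q)%:E.
  elim: p => [|p ih]; first by rewrite big_nil big_geq.
  by rewrite /= big_cat/= EFinD ih big_nat_recr.
pose W := \sum_(0 <= k <oo) (\sum_(q <- s k) w q)%:E.
have ws0 k : 0 <= (\sum_(q <- s k) w q)%:E by rewrite lee_fin sumr_ge0.
pose Z := \bigcup_p cover (s p).
have SZ p : cover (S p) `<=` Z.
  elim: p => [|p ih] x /=; first by case.
  case=> i; rewrite mem_cat => /orP[iS|iS] Ux; first by apply: ih; exists i.
  by exists p => //; exists i.
have key q i : h (ep q) (E i `\` Z) + W <= (L + eps)%:E.
  have hp p : (q <= p)%N ->
      h (ep q) (E i `\` Z) + \sum_(0 <= k < p) (\sum_(q <- s k) w q)%:E <= (L + eps)%:E.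
    move=> qp; rewrite -SE; apply: (@le_trans _ _ (B p)%:E); last by rewrite lee_fin.
    apply: le_trans (InvS p i); rewrite leeD2r//.
    by apply: le_cover_content; [exact/le_adm/ep_le|exact: setDS].
  have hfin : h (ep q) (E i `\` Z) \is a fin_num.
    rewrite ge0_fin_numE//; apply: le_lt_trans (ltry (L + eps)).
    by apply: le_trans (hp q (leqnn _)); rewrite leeDl// sume_ge0.
  rewrite addeC -leeBrDr//; apply: lime_le; first exact: is_cvg_nneseries.
  by near=> p; rewrite leeBrDr// addeC; apply: hp; near: p; exact: nbhs_infty_ge.
have Wfin : W \is a fin_num.
  rewrite ge0_fin_numE; last exact: nneseries_ge0.
  apply: le_lt_trans (ltry (L + eps)); apply: le_trans (key 0%N 0%N).
  by rewrite leeDr.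
have HF i : hausdorff (E i `\` Z) <= (L + eps)%:E - W.
  apply: ge_ereal_sup => _ [a /= a0 <-].
  have [q qa] : exists q, (ep q <= a)%R.
    have [q hq] : exists q : nat, (e / a <= q%:R)%R.
      exists (Num.truncn `|(e / a)%R|%R).+1; rewrite ltW// (le_lt_trans (ler_norm _))//.
      exact: truncnS_gt.
    exists q; rewrite /ep ler_pdivrMr ?exprn_gt0// mulrC -ler_pdivrMr//.
    by rewrite (le_trans hq)// -natrX ler_nat ltnW// ltn_expl.
  rewrite leeBrDr//; apply: le_trans (key q i); rewrite leeD2r//.
  by apply: le_cover_content => //; exact: le_adm.
have HU : hausdorff ((\bigcup_i E i) `\` Z) <= (L + eps)%:E - W.
  rewrite setDE setI_bigcupl; apply: (le_trans (hausdorff_bigcup _)).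
    by move=> i j ij; apply/subsetPset; apply: setSD; apply/subsetPset/ndE.
  by apply: ge_ereal_sup => _ [i _ <-] /=; rewrite -setDE.
apply: (@le_trans _ _ (h e' Z + h e' ((\bigcup_i E i) `\` Z))).
  apply: (@le_trans _ _ (h e' (Z `|` ((\bigcup_i E i) `\` Z)))); last first.
    exact: cover_contentU2.
  apply: le_cover_content => // x Ex.
  by have [Zx|nZx] := pselect (Z x); [left|right].
rewrite -(subeK (L + eps)%:E Wfin) [leRHS]addeC; apply: leeD; last first.
  apply: le_trans HU; apply: ereal_sup_ubound; exists e' => //=.
  exact: lt_trans ee.
apply: (@le_trans _ _ (\sum_(0 <= k <oo) h e' (cover (s k)))).
  exact: cover_content_sigma_subadditive.
apply: lee_nneseries => [k _ _|k _]; first exact: cover_content_ge0.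
by apply: cover_content_seq.
Unshelve. all: by end_near. Qed.

End increasing_sets.

(** With vanishing weights a content takes only the values [0] and [+oo], and
    countable subadditivity is enough. *)
Lemma cover_content_bigcup_weight0 {R : realType} {T : Type} {I : pointedType}
    (U : I -> set T) (w : I -> R) (adm : set I) (E : (set T)^nat) :
  (forall i, adm i -> w i = 0) -> (forall i, 0 <= w i) ->
  (cover_content U w adm (\bigcup_i E i) <=
   ereal_sup (range (fun i => cover_content U w adm (E i))))%E.
Proof.
move=> w0 wge0; set L := ereal_sup _; have [->|Loo] := eqVneq L +oo%E; first by rewrite leey.
have hE i : cover_content U w adm (E i) = 0%E.
  apply/eqP; rewrite eq_le cover_content_ge0// andbT.
  have /cover_content_lt [D [b [Db Eb _]]] : (cover_content U w adm (E i) < +oo)%E.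
    by rewrite (@le_lt_trans _ _ L) ?ltey//; apply: ereal_sup_ubound; exists i.
  by rewrite (le_trans (cover_content_lb w Db Eb))// esum1// => j Dj; rewrite w0//; exact: Db.
apply: (@le_trans _ _ (\sum_(0 <= i <oo) cover_content U w adm (E i))%E).
  exact: cover_content_sigma_subadditive.
rewrite eseries0 => [|i _ _]; last exact: hE.
by apply: le_ereal_sup_tmp; exists 0%E => //; exists 0%N => //; rewrite /= hE.
Qed.

(** * Euclidean geometry of tuples *)

Lemma cauchy_schwarz_sum {R : realFieldType} {J : finType} (a b : J -> R) :
  (\sum_i a i * b i) ^+ 2 <= (\sum_i a i ^+ 2) * (\sum_i b i ^+ 2).
Proof.
set A := \sum_i a i ^+ 2; set B := \sum_i b i ^+ 2; set C := \sum_i _.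
have A0 : 0 <= A by apply: sumr_ge0 => i _; exact: sqr_ge0.
have [A00|An0] := eqVneq A 0.
  have a0 i : a i = 0.
    apply/eqP; rewrite -sqrf_eq0; move/eqP: A00; rewrite psumr_eq0.
      by move=> /allP/(_ i); rewrite mem_index_enum => /(_ isT).
    by move=> j _; exact: sqr_ge0.
  rewrite A00 mul0r [C]big1 ?expr0n// => i _; by rewrite a0 mul0r.
have : 0 <= \sum_i (A * b i - C * a i) ^+ 2 by apply: sumr_ge0 => i _; exact: sqr_ge0.
have -> : \sum_i (A * b i - C * a i) ^+ 2 = A * (A * B - C ^+ 2).
  rewrite (eq_bigr (fun i => A ^+ 2 * b i ^+ 2 +
    (- (2 * A * C) * (a i * b i) + C ^+ 2 * a i ^+ 2))) => [|i _]; last by ring.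
  rewrite !big_split/= -!mulr_sumr -/A -/B -/C; ring.
by rewrite pmulr_rge0 ?lt0r ?An0// subr_ge0.
Qed.

Section euclidean_norm.
Context {R : realType} {k n : nat}.
Implicit Types (x y z c : 'M[R]_(k, n)) (rho : R).

Lemma enorm_pairE x : enorm x = Num.sqrt (\sum_(p : 'I_k * 'I_n) x p.1 p.2 ^+ 2).
Proof. by rewrite /enorm pair_big. Qed.

Lemma enorm_ge0 x : 0 <= enorm x.
Proof. exact: sqrtr_ge0. Qed.

Lemma enorm_triangle x y : enorm (x + y) <= enorm x + enorm y.
Proof.
rewrite !enorm_pairE.
set X := \sum_p x _ _ ^+ 2; set Y := \sum_p y _ _ ^+ 2.
have X0 : 0 <= X by apply: sumr_ge0 => p _; exact: sqr_ge0.
have Y0 : 0 <= Y by apply: sumr_ge0 => p _; exact: sqr_ge0.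
rewrite -(ler_pXn2r (n := 2)) ?nnegrE ?sqrtr_ge0 ?addr_ge0 ?sqrtr_ge0//.
rewrite sqr_sqrtr; last by apply: sumr_ge0 => p _; exact: sqr_ge0.
rewrite sqrrD !sqr_sqrtr//.
under eq_bigr => p _ do rewrite mxE sqrrD.
rewrite !big_split/= -/X -/Y lerD2r lerD2l -mulr2n lerMn2r/=.
apply: (le_trans (ler_norm _)); rewrite -sqrtrM// -sqrtr_sqr ler_wsqrtr//.
exact: (cauchy_schwarz_sum (fun p : 'I_k * 'I_n => x p.1 p.2)).
Qed.

Lemma enormZ (a : R) x : enorm (a *: x) = `|a| * enorm x.
Proof.
rewrite !enorm_pairE -sqrtr_sqr -sqrtrM ?sqr_ge0// mulr_sumr; congr Num.sqrt.
by apply: eq_bigr => p _; rewrite mxE exprMn.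
Qed.

Lemma enorm0 : enorm (0 : 'M[R]_(k, n)) = 0.
Proof. by rewrite -(scale0r 0) enormZ normr0 mul0r. Qed.

Lemma enormN x : enorm (- x) = enorm x.
Proof. by rewrite -scaleN1r enormZ normrN1 mul1r. Qed.

Lemma enorm_distC x y : enorm (x - y) = enorm (y - x).
Proof. by rewrite -enormN opprB. Qed.

Lemma enorm_dist_triangle y x z : enorm (x - z) <= enorm (x - y) + enorm (y - z).
Proof. by rewrite -[in leLHS](subrKA y); exact: enorm_triangle. Qed.

Lemma le_enorm_entry x i j : `|x i j| <= enorm x.
Proof.
rewrite enorm_pairE -sqrtr_sqr ler_wsqrtr// (bigD1 (i, j))//= lerDl.
by apply: sumr_ge0 => p _; exact: sqr_ge0.
Qed.

(** This is what relates the Euclidean norm to the topology of matrices, which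
    comes from the sup norm. *)
Lemma continuous_enormB c : continuous (fun x => enorm (x - c)).
Proof.
move=> x; rewrite /enorm.
apply: (@continuous_comp _ _ _
  (fun y : 'M[R]_(k, n) => \sum_i \sum_j ((y - c) i j) ^+ 2) Num.sqrt); last exact: sqrt_continuous.
apply: continuous_big => [|i _]; first exact: add_continuous.
apply: continuous_big => [|j _]; first exact: add_continuous.
have -> : (fun y : 'M[R]_(k, n) => (y - c) i j ^+ 2) =
    (fun t : R => (t - c i j) ^+ 2) \o (fun y : 'M[R]_(k, n) => y i j).
  by apply/funext => y /=; rewrite !mxE.
move=> y; apply: continuous_comp; first exact: coord_continuous.
apply: (@continuous_comp _ _ _ (fun t : R => t - c i j) (fun t : R => t ^+ 2)).
  by apply: cvgB; [exact: cvg_id|exact: cvg_cst].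
exact: exprn_continuous.
Qed.

Lemma open_eball c rho : open (eball c rho).
Proof.
rewrite (_ : eball c rho = (fun x => enorm (x - c)) @^-1` [set t | t < rho])//.
apply: open_comp; last exact: open_lt.
by move=> x _; exact: continuous_enormB.
Qed.

Lemma eballB c rho x y : eball c rho x -> eball c rho y -> enorm (x - y) < rho + rho.
Proof.
rewrite /eball/= => xc yc; apply: (le_lt_trans (enorm_dist_triangle c _ _)).
by rewrite ltrD// enorm_distC.
Qed.

Lemma le_ediam_eball c rho x y : eball c rho x -> eball c rho y ->
  enorm (x - y) <= ediam (eball c rho).
Proof.
move=> xc yc; apply: ub_le_sup; last by exists x => //; exists y.
by exists (rho + rho) => _ [x' x'c [y' y'c <-]]; exact/ltW/(eballB x'c).
Qed.

(** The diameter is left proportional to the radius, with an unspecified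
    factor, so that the space of dimension [0], where the factor is [0], is not
    an exception. *)
Lemma ediam_eball c rho : 0 < rho ->
  ediam (eball c rho) = ediam (eball (0 : 'M[R]_(k, n)) 1) * rho.
Proof.
move=> rho0.
have sc x : enorm x < rho -> enorm (rho^-1 *: x) < 1.
  by move=> xr; rewrite enormZ gtr0_norm ?invr_gt0// ltr_pdivrMl// mulr1.
have cs x : enorm x < 1 -> enorm (rho *: x) < rho.
  by move=> xr; rewrite enormZ gtr0_norm// gtr_pMr.
apply/eqP; rewrite eq_le; apply/andP; split.
  apply: ge_sup.
    by exists 0; exists c; rewrite /eball/= ?subrr ?enorm0//; exists c; rewrite /= ?subrr ?enorm0.
  move=> _ [x xc [y yc <-]].
  rewrite -ler_pdivrMr// mulrC -[rho^-1]gtr0_norm ?invr_gt0// -enormZ.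
  have -> : rho^-1 *: (x - y) = rho^-1 *: (x - c) - rho^-1 *: (y - c).
    by rewrite -scalerBr opprB addrA subrK.
  by apply: le_ediam_eball; rewrite /eball/= subr0; exact: sc.
rewrite -ler_pdivlMr//; apply: ge_sup.
  by exists 0; exists 0; rewrite /eball/= ?subrr ?enorm0//; exists 0; rewrite /= ?subrr ?enorm0.
move=> _ [x + [y + <-]]; rewrite /eball/= !subr0 => x1 y1.
rewrite ler_pdivlMr// mulrC -[X in X * _]gtr0_norm// -enormZ.
have -> : rho *: (x - y) = (c + rho *: x) - (c + rho *: y).
  by rewrite opprD addrACA subrr add0r -scalerBr.
by apply: le_ediam_eball; rewrite /eball/= addrAC subrr add0r; exact: cs.
Qed.

Lemma compact_entries (b : R) : compact [set x : 'M[R]_(k, n) | forall i j, `|x i j| <= b].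
Proof.
have -> : [set x : 'M[R]_(k, n) | forall i j, `|x i j| <= b] =
    vec_mx @` [set v : 'rV[R]_(k * n) | forall p, `[- b, b]%classic (v ord0 p)].
  apply/seteqP; split => [x /= xb|_ [v /= vb <-] i j].
    exists (mxvec x); last by rewrite mxvecK.
    by move=> p; case/mxvec_indexP: p => i j; rewrite /= mxvecE in_itv/= -ler_norml.
  by rewrite mxE; have := vb (mxvec_index i j); rewrite /= in_itv/= -ler_norml.
apply: continuous_compact; last first.
  by apply: (@rV_compact R _ (fun=> `[- b, b]%classic)) => p; exact: segment_compact.
apply: continuous_subspaceT => v A /nbhs_ballP[e e0 eA].
apply/nbhs_ballP; exists e => // u uv; apply: eA; split => // i j.
by rewrite !mxE; exact: uv.2.
Qed.

End euclidean_norm.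

(** * The spherical measure *)

Section spherical_measure.
Context {R : realType} {k n : nat}.
Implicit Types (d e rho : R) (A : set 'M[R]_(k, n)) (p : 'M[R]_(k, n) * R).

Definition ball_of p : set 'M[R]_(k, n) := eball p.1 p.2.

Definition ball_weight d p : R := omega d * 2 `^ (- d) * ediam (ball_of p) `^ d.

Definition small_ball e : set ('M[R]_(k, n) * R) :=
  [set p | 0 < p.2 /\ ediam (ball_of p) < e].

Lemma gamma_fun_ge0 (s : R) : 0 <= gamma_fun s.
Proof.
by apply: Rintegral_ge0 => t _; rewrite mulr_ge0 ?powR_ge0 ?expR_ge0.
Qed.

Lemma ball_coeff_ge0 d : 0 <= omega d * 2 `^ (- d).
Proof. by rewrite mulr_ge0 ?powR_ge0// divr_ge0 ?powR_ge0 ?gamma_fun_ge0. Qed.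

Lemma ball_weight_ge0 d p : 0 <= ball_weight d p.
Proof. by rewrite mulr_ge0 ?ball_coeff_ge0 ?powR_ge0. Qed.

Lemma le_small_ball e e' : e <= e' -> small_ball e `<=` small_ball e'.
Proof. by move=> ee p [p0 pe]; split => //; exact: lt_le_trans ee. Qed.

Lemma spherical_contentE d e A :
  spherical_content d e A = cover_content ball_of (ball_weight d) (small_ball e) A.
Proof.
congr ereal_inf; apply/seteqP; split => v.
  by move=> [D [c [rho [Dc Ac ->]]]]; exists D, (fun i => (c i, rho i)).
by move=> [D [b [Db Ab ->]]]; exists D, (fun i => (b i).1), (fun i => (b i).2).
Qed.

Local Notation H d := (hausdorff_content ball_of (ball_weight d) small_ball).

Lemma spherical_hausdorffE d A : spherical_hausdorff d A = H d A.
Proof.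
rewrite /spherical_hausdorff.
have h_anti : {in `]0, +oo[ &,
    {homo (fun e => spherical_content d e A) : e e' / e <= e' >-> (e' <= e)%E}}.
  move=> e e' _ _ ee; rewrite !spherical_contentE; apply: le_cover_content => //.
  exact: le_small_ball.
have /cvg_lim -> // := nonincreasing_at_right_cvge +oo%O isT h_anti.
congr ereal_sup; apply/seteqP; split => [_ [e e0 <-]|_ [e e0 <-]].
  exists e; last by rewrite spherical_contentE.
  by move: e0; rewrite /= in_itv/= andbT.
by exists e; [rewrite /= in_itv/= andbT | rewrite spherical_contentE].
Qed.

Definition spherical_outer_measure d : {outer_measure set 'M[R]_(k, n) -> \bar R} :=
  hausdorff_outer_measure ball_of (ball_weight_ge0 d) small_ball.

Lemma caratheodory_ball_of d p : (spherical_outer_measure d).-caratheodory (ball_of p).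
Proof.
have -> : ball_of p = [set x | 0 < p.2 - enorm (x - p.1)].
  by apply/seteqP; split => x /=; rewrite subr_gt0.
apply: metric_caratheodory => A B delta delta0 sep.
apply: (hausdorff_content_separated (ball_weight_ge0 d) le_small_ball delta0).
move=> q [_ qd] [x [qx Ax]] [y [qy By]].
have := sep x y Ax By; have := le_ediam_eball qy qx.
have := enorm_dist_triangle x y p.1; rewrite /ball_of in qd; lra.
Qed.

Lemma hausdorff_content_bigcup d (F : (set 'M[R]_(k, n))^nat) :
  nondecreasing_seq F ->
  (H d (\bigcup_i F i) <= ereal_sup (range (H d \o F)))%E.
Proof.
apply: (@regular_outer_bigcup _ _ (spherical_outer_measure d)).
apply: hausdorff_outer_measure_regular; first exact: le_small_ball.
exact: caratheodory_ball_of.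
Qed.

Definition unit_diam : R := ediam (eball (0 : 'M[R]_(k, n)) 1).

Lemma ediam_ball_of p : 0 < p.2 -> ediam (ball_of p) = unit_diam * p.2.
Proof. exact: ediam_eball. Qed.

Lemma unit_diam_ge0 : 0 <= unit_diam.
Proof.
have b0 : eball 0 1 (0 : 'M[R]_(k, n)) by rewrite /eball/= subrr enorm0.
by have := le_ediam_eball b0 b0; rewrite subrr enorm0.
Qed.

Lemma small_ball_rho e eta p : 0 < eta -> small_ball e p -> ~ small_ball eta p ->
  [/\ 0 < unit_diam, eta <= unit_diam * p.2 & unit_diam * p.2 < e].
Proof.
move=> eta0 [p0 pe] peta; rewrite -ediam_ball_of//.
have etap : eta <= ediam (ball_of p).
  by rewrite leNgt; apply/negP => h; apply: peta.
split => //; rewrite lt_def unit_diam_ge0 andbT; apply: contraTneq etap => u0.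
by rewrite ediam_ball_of// u0 mul0r -ltNge.
Qed.

Lemma ball_weight_lb d e eta : 0 <= d -> 0 < omega d * 2 `^ (- d) -> 0 < eta ->
  exists2 w0, 0 < w0 & forall p, small_ball e p -> ~ small_ball eta p -> w0 <= ball_weight d p.
Proof.
move=> d0 c0 eta0; exists (omega d * 2 `^ (- d) * eta `^ d).
  by rewrite mulr_gt0// powR_gt0.
move=> p pe peta; have [u0 h _] := small_ball_rho eta0 pe peta.
rewrite ler_wpM2l ?(ltW c0)// ge0_ler_powR// ?nnegrE ?(ltW eta0)//.
  by rewrite ediam_ball_of ?(le_trans _ h) ?ltW//; case: pe.
by rewrite ediam_ball_of//; case: pe.
Qed.

(** Continuity of the power function at [1], in the form used to enlarge
    balls. *)
Lemma powR_one_plus d (eps : R) : 0 <= d -> 0 < eps ->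
  exists2 s, 0 < s & (1 + s) `^ d <= 1 + eps.
Proof.
move=> d0 eps0; have [->|dn0] := eqVneq d 0.
  by exists 1 => //; rewrite powRr0 lerDl ltW.
have dp : 0 < d by rewrite lt_def dn0.
exists ((1 + eps) `^ d^-1 - 1).
  have : 1 `^ d^-1 < (1 + eps) `^ d^-1.
    by rewrite gt0_ltr_powR ?invr_gt0 ?nnegrE ?addr_ge0 ?(ltW eps0)// ltrDl.
  by rewrite powR1 subr_gt0.
by rewrite addrC subrK -powRrM mulVf// powRr1// addr_ge0// ltW.
Qed.

Lemma finite_centers (b tau : R) : 0 < tau ->
  exists Z : seq 'M[R]_(k, n), forall c, enorm c <= b -> exists2 z, z \in Z & enorm (z - c) < tau.
Proof.
move=> tau0; have := @compact_entries R k n b; rewrite compact_cover.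
move=> /(_ _ setT (fun z => eball z tau)) [z _|x _|Z _ ZP].
- exact: open_eball.
- by exists x => //; rewrite /eball/= subrr enorm0.
- exists (finmap.enum_fset Z) => c cb.
  have [|z zZ zc] := ZP c.
    by move=> i j /=; exact: le_trans (le_enorm_entry _ _ _) cb.
  by exists z => //; rewrite enorm_distC.
Qed.

(** Centres are rounded to a finite [tau]-dense set and radii up to a multiple
    of [tau], with a margin of [tau] at least, so that the rounded ball
    contains the given one.  Large balls have radius bounded below,
    so the relative increase of the radius, hence of the weight, is small. *)
Lemma ball_net d (b e e' eta e0 : R) :
  0 <= d -> 0 < eta -> e < e' -> 0 < e0 ->
  exists N : seq ('M[R]_(k, n) * R), {in N, forall q, small_ball e' q} /\
    forall p, small_ball e p -> ~ small_ball eta p ->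
      ball_of p `&` [set x | enorm x <= b] !=set0 ->
      exists2 q, q \in N & ball_of p `<=` ball_of q /\
        ball_weight d q <= ball_weight d p + e0.
Proof.
move=> d0 eta0 ee e00.
have [u0|u0] := ltP 0 unit_diam; last first.
  by exists [::]; split => // p pe peta; have [] := small_ball_rho eta0 pe peta; rewrite ltNge u0.
set u := unit_diam in u0 *.
set cf := omega d * 2 `^ (- d).
have cf0 : 0 <= cf by exact: ball_coeff_ge0.
pose Wm := cf * e `^ d.
have Wm0 : 0 <= Wm by rewrite mulr_ge0// powR_ge0.
have [s s0 hs] := @powR_one_plus d (e0 / (Wm + 1)) d0 (divr_gt0 e00 (ltr_wpDl Wm0 ltr01)).
(* Twice [tau], multiplied by [u], fits below the increase by the factor [1 + s]
   of a diameter [eta], and below the gap between [e] and [e']. *)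
pose tau := Num.min (eta * s / (2 * u)) ((e' - e) / (2 * u)).
have u20 : 0 < 2 * u by rewrite mulr_gt0.
have tau0 : 0 < tau by rewrite lt_min !divr_gt0 ?mulr_gt0 ?subr_gt0.
have tau1 : tau * (2 * u) <= eta * s by rewrite -ler_pdivlMr// ge_min lexx.
have tau2 : tau * (2 * u) <= e' - e by rewrite -ler_pdivlMr// ge_min lexx orbT.
have [Z ZP] := finite_centers (b + e / u) tau0.
pose M := (Num.truncn `|e / u / tau|).+4.
exists [seq q <- [seq (z, i%:R * tau) | z <- Z, i <- iota 0 M] | `[< small_ball e' q >]].
split=> [q|p pe peta [x [px xb]]]; first by rewrite mem_filter => /andP[/asboolP].
have [_ up1 up2] := small_ball_rho eta0 pe peta; rewrite -/u in up1 up2.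
have [p0 _] := pe.
have pu : p.2 < e / u by rewrite ltr_pdivlMr// mulrC.
have [|z zZ zp] := ZP p.1.
  rewrite -[p.1](subrK x) addrC; apply: (le_trans (enorm_triangle _ _)).
  rewrite lerD// enorm_distC; apply: ltW; exact: lt_trans pu.
pose i := (Num.truncn (p.2 / tau)).+2.
have pt0 : 0 <= p.2 / tau by rewrite divr_ge0 ?ltW.
have /andP[i1 i2] := truncn_itv pt0.
rewrite ler_pdivlMr// in i1; rewrite ltr_pdivrMr// in i2.
have iE : i%:R * tau = (Num.truncn (p.2 / tau))%:R * tau + 2 * tau.
  by rewrite /i -addn2 natrD mulrDl.
have iE' : (Num.truncn (p.2 / tau)).+1%:R * tau = (Num.truncn (p.2 / tau))%:R * tau + tau.
  by rewrite -addn1 natrD mulrDl mul1r.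
rewrite iE' in i2.
pose q := (z, i%:R * tau).
have q1 : q.2 <= p.2 + 2 * tau by rewrite /q/= iE; lra.
have q2 : p.2 + tau <= q.2 by rewrite /q/= iE; lra.
have q0 : 0 < q.2 by lra.
have uq : u * q.2 <= u * p.2 + tau * (2 * u).
  by rewrite (le_trans (ler_wpM2l (ltW u0) q1))// mulrDr lerD2l; lra.
exists q.
  rewrite mem_filter; apply/andP; split.
    by apply/asboolP; split => //; rewrite ediam_ball_of//; rewrite -/u; lra.
  apply/allpairsP; exists (z, i); split => //.
  rewrite mem_iota leq0n add0n ltnS /M /i !ltnS leqW// le_truncn//.
  by rewrite (le_trans _ (ler_norm _))// ler_pM2r ?invr_gt0// ltW.
split.
  move=> y; rewrite /ball_of /eball/= => yp.
  have := enorm_dist_triangle p.1 y z; rewrite (enorm_distC p.1); rewrite /q/= in q2; lra.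
rewrite /ball_weight -/cf !ediam_ball_of// -/u.
have up0 : 0 <= u * p.2 by rewrite mulr_ge0 ?ltW.
apply: (@le_trans _ _ (cf * ((u * p.2) * (1 + s)) `^ d)).
  rewrite ler_wpM2l// ge0_ler_powR// ?nnegrE;
    [by rewrite mulr_ge0 ?ltW|by rewrite mulr_ge0// addr_ge0// ltW|].
  apply: (le_trans uq); rewrite mulrDr mulr1 lerD2l (le_trans tau1)//.
  by rewrite ler_wpM2r// ltW.
rewrite powRM ?addr_ge0 ?(ltW s0)// mulrA.
set W := cf * (u * p.2) `^ d.
have WM : W <= Wm.
  by rewrite ler_wpM2l// ge0_ler_powR// ?nnegrE ?ltW// (le_lt_trans up0).
have W0 : 0 <= W by rewrite mulr_ge0// powR_ge0.
apply: (le_trans (ler_wpM2l W0 hs)); rewrite mulrDr mulr1 lerD2l.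
rewrite mulrA ler_pdivrMr; last by lra.
rewrite mulrC ler_wpM2l ?(ltW e00)//; lra.
Qed.

End spherical_measure.

Section spherical_content.
Context {R : realType} {k n : nat}.
Implicit Types (d e : R) (A : set 'M[R]_(k, n)).

(** The hypothesis on [d] fails only for negative exponents in positive
    dimension.  The increasing sets lemma applies when the weights of large
    balls are bounded below; otherwise all weights vanish. *)
Lemma spherical_content_bigcup d (b e e' : R) (E : (set 'M[R]_(k, n))^nat) :
  0 <= d \/ @unit_diam R k n = 0 ->
  nondecreasing_seq E -> (forall i, E i `<=` [set x | enorm x <= b]) ->
  0 < e -> e < e' ->
  (spherical_content d e' (\bigcup_i E i) <=
   ereal_sup (range (fun i => spherical_content d e (E i))))%E.
Proof.
move=> d0 ndE Eb e0 ee; rewrite spherical_contentE.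
rewrite (_ : (fun i => spherical_content d e (E i)) =
    (fun i => cover_content ball_of (ball_weight d) (small_ball e) (E i))); last first.
  by apply/funext => i; rewrite spherical_contentE.
have [[dge0 c0]|w0] : (0 <= d /\ 0 < omega d * 2 `^ (- d)) \/
    (forall p : 'M[R]_(k, n) * R, 0 < p.2 -> ball_weight d p = 0).
  have [c0|/negP] := boolP (0 < omega d * 2 `^ (- d)); last first.
    rewrite lt_def ball_coeff_ge0 andbT => /negP; rewrite negbK => /eqP c0.
    by right => p _; rewrite /ball_weight c0 mul0r.
  have [dge0|dlt0] := leP 0 d; first by left.
  right => p p0; case: d0; first by rewrite leNgt dlt0.
  by move=> u0; rewrite /ball_weight ediam_ball_of// u0 mul0r powR0 ?mulr0// lt_eqF.
  apply: (@cover_content_bigcup _ _ _ _ _ (ball_weight_ge0 d) _ [set x | enorm x <= b]) => //.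
  - exact: le_small_ball.
  - by move=> a eta eta0; exact: ball_weight_lb.
  - by move=> a a' eta a0 *; exact: ball_net.
  - exact: hausdorff_content_bigcup.
apply: (@le_trans _ _ (cover_content ball_of (ball_weight d) (small_ball e) (\bigcup_i E i))).
  by apply: le_cover_content => //; apply: le_small_ball; exact: ltW.
apply: cover_content_bigcup_weight0; last exact: ball_weight_ge0.
by move=> p [p0 _]; exact: w0.
Qed.

Lemma le_spherical_content d e e' A B : e <= e' -> A `<=` B ->
  (spherical_content d e' A <= spherical_content d e B)%E.
Proof.
move=> ee AB; rewrite !spherical_contentE; apply: le_cover_content => //.
exact: le_small_ball.
Qed.

Lemma spherical_content_open d e A (t : \bar R) : (spherical_content d e A < t)%E ->
  exists O, [/\ open O, A `<=` O & (spherical_content d e O < t)%E].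
Proof.
rewrite spherical_contentE => /cover_content_lt [D [b [Db Ab bt]]].
exists (\bigcup_(i in D) ball_of (b i)); split => //.
  by apply: bigcup_open => i _; exact: open_eball.
by rewrite spherical_contentE (le_lt_trans _ bt)//; exact: cover_content_lb.
Qed.

End spherical_content.

Lemma spherical_hausdorff_sup {R : realType} {k n : nat} (d : R) (A : set 'M[R]_(k, n)) :
  spherical_hausdorff d A = ereal_sup [set spherical_content d e A | e in [set e : R | 0 < e]].
Proof.
rewrite spherical_hausdorffE; congr ereal_sup; apply/seteqP.
by split => _ [e e0 <-]; exists e; rewrite ?spherical_contentE.
Qed.

Lemma unit_diam0 {R : realType} {n : nat} : @unit_diam R 0 n = 0.
Proof.
rewrite /unit_diam ediam_eball ?mulr1//.
rewrite /ediam (_ : [set _ | _ in _ & _ in _] = [set 0]) ?sup1//.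
have e0 (x : 'M[R]_(0, n)) : enorm x = 0 by rewrite /enorm big_ord0 sqrtr0.
apply/seteqP; split => [_ [x _ [y _ <-]]|_ ->]; first by rewrite e0.
by exists 0; rewrite /eball/= ?e0//; exists 0; rewrite /= ?e0.
Qed.

(** * Sections of Suslin sets *)

Section capacitability.
Context {R : realType} {T : topologicalType} {Y : ptopologicalType}.
Variables (h : R -> set T -> \bar R) (C : set T).
Local Notation borelY := (g_sigma_algebraType (@open Y)).
Variable P : probability borelY R.
Hypothesis le_h : forall e e' A B, e <= e' -> A `<=` B -> (h e' A <= h e B)%E.
Hypothesis h_bigcup : forall (e e' : R) (E : (set T)^nat),
  nondecreasing_seq E -> (forall i, E i `<=` C) -> 0 < e -> e < e' ->
  (h e' (\bigcup_i E i) <= ereal_sup (range (fun i => h e (E i))))%E.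
Hypothesis h_open : forall e A (t : \bar R), (h e A < t)%E ->
  exists O, [/\ open O, A `<=` O & (h e O < t)%E].
Hypothesis compactC : compact C.

Local Notation section G y := [set x | G (x, y)].

(** The tube lemma: projecting along the compact set [C] preserves closed
    sets. *)
Lemma open_section_sub (G : set (T * Y)) (O : set T) :
  closed G -> G `<=` C `*` setT -> open O -> open [set y | section G y `<=` O].
Proof.
move=> cG GC oO; rewrite openE => y0 Gy0.
suff : \forall y \near y0, C `<=` [set x | G (x, y) -> O x].
  rewrite /interior/=; apply: filterS => y Cy x Gxy.
  by apply: Cy => //; have [] := GC _ Gxy.
have /compact_near_coveringP := compactC.
apply => x Cx.
have [Ox|nOx] := pselect (O x).
  exists (O, setT) => /=; last by case=> ? ? [].
  by split; [exact: open_nbhs_nbhs | exact: filterT].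
have nG : (~` G) (x, y0) by move=> Gxy; apply: nOx; exact: Gy0.
have : nbhs (x, y0) (~` G) by apply: open_nbhs_nbhs; split => //; exact: closed_openC.
by apply: filterS => -[x' y] /= nGx /nGx.
Qed.

Lemma open_content_lt (G : set (T * Y)) e (t : \bar R) :
  closed G -> G `<=` C `*` setT -> open [set y | (h e (section G y) < t)%E].
Proof.
move=> cG GC; rewrite openE => y0 /= /h_open [V [oV GV hV]].
have := open_section_sub cG GC oV; rewrite openE => /(_ y0 GV).
rewrite /interior; apply: filterS => y GyV /=; apply: le_lt_trans hV.
exact: le_h.
Qed.

Lemma content_bigcap_compact (G : nat -> set T) e (t : \bar R) :
  (forall l, closed (G l)) -> (forall l, G l `<=` C) -> nonincreasing_seq G ->
  (forall l, t <= h e (G l))%E -> (t <= h e (\bigcap_l G l))%E.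
Proof.
move=> cG GC dG hG; rewrite leNgt; apply/negP => /h_open [V [oV GV hV]].
have /compact_near_coveringP cC := compactC.
have [|l _] := cC nat \oo (fun l x => G l x -> V x).
  move=> x Cx; have [Vx|nVx] := pselect (V x).
    exists (V, setT); last by case=> ? ? [].
    by split; [exact: open_nbhs_nbhs | exact: filterT].
  have [l nGl] : exists l, ~ G l x.
    by apply/existsNP => Gx; apply: nVx; apply: GV => l _; exact: Gx.
  exists (~` G l, [set l' | (l <= l')%N]) => /=.
    split; last exact: nbhs_infty_ge.
    by apply: open_nbhs_nbhs; split => //; exact: closed_openC.
  move=> [x' l'] [/= nG ll' Gl']; exfalso; apply: nG.
  by move: (x') Gl'; apply/subsetPset/dG.
move=> /(_ l (leqnn l)) Cl; have := hG l; rewrite leNgt => /negP; apply.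
by apply: le_lt_trans hV; apply: le_h => // x Gx; apply: Cl => //; exact: GC Gx.
Qed.

Variable F : seq nat -> set (T * Y).
Hypothesis closedF : forall a s, closed (F (a :: s)).
Hypothesis F_C : forall a s, F (a :: s) `<=` C `*` setT.

(** The section at [y] of the Suslin set of the scheme [F]; as in a Suslin
    operation, the prefixes have length at least [1]. *)
Definition suslin_section (y : Y) : set T :=
  [set x | exists phi : nat -> nat, forall l, F (mkseq phi l.+1) (x, y)].

Let bounded_section (N : seq nat) (y : Y) : set T :=
  [set x | exists phi : nat -> nat,
    (forall i, (i < size N)%N -> (phi i <= nth 0 N i)%N) /\
    forall l, F (mkseq phi l.+1) (x, y)].

Let bounded_sectionC N y : bounded_section N y `<=` C.
Proof. by move=> x [phi [_ /(_ 0%N)]] /F_C []. Qed.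

Let bounded_section_rcons N y :
  bounded_section N y `<=` \bigcup_b bounded_section (rcons N b) y.
Proof.
move=> x [phi [phiN phiF]]; exists (phi (size N)) => //; exists phi; split => // i.
rewrite size_rcons ltnS leq_eqVlt nth_rcons => /predU1P[->|iN].
  by rewrite ltnn eqxx.
by rewrite iN phiN.
Qed.

Let bounded_section_nd N y : nondecreasing_seq (fun b => bounded_section (rcons N b) y).
Proof.
move=> b b' bb; apply/subsetPset => x [phi [phiN phiF]]; exists phi; split => // i.
move=> iN; apply: (leq_trans (phiN i _)); first by move: iN; rewrite !size_rcons.
by rewrite !nth_rcons; case: ifP => //; case: ifP.
Qed.

Let Pmu : {outer_measure set borelY -> \bar R} := (P^*)%mu.

(* Every level of the scheme costs a strict decrease of the scale; these scales
   decrease from [e] but stay above [e / 2]. *)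
Let delta (e : R) (l : nat) : R := e / 2 + e / 2 / l.+1%:R.

(** At level [l], the sections with one more index bounded by [b] increase with
    [b] to the sections of the previous level.  By the increasing sets lemma
    the level sets of their contents exhaust those of the previous level, and
    the outer probability is continuous along increasing sequences, so some
    [b] keeps it above [a]. *)
Lemma choose_bound (a : \bar R) (t e : R) : 0 < e ->
  (a < Pmu [set y | t%:E < h e (suslin_section y)])%E ->
  exists N : nat -> nat, forall l,
    (a < Pmu [set y | t%:E < h (delta e l) (bounded_section (mkseq N l) y)])%E.
Proof.
move=> e0 at0.
pose Q (s : seq nat) := (a < Pmu [set y | t%:E < h (delta e (size s)) (bounded_section s y)])%E.
have Q0 : Q [::].
  apply: (lt_le_trans at0); apply: le_outer_measure => y /= /lt_le_trans; apply.
  apply: le_h; first by rewrite /delta divr1 -splitr.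
  by move=> x [phi phiF]; exists phi.
have step s : exists b, Q s -> Q (rcons s b).
  have [Qs|nQs] := pselect (Q s); last by exists 0%N.
  have ded : delta e (size s).+1 < delta e (size s).
    by rewrite ltrD2l ltr_pM2l ?divr_gt0// ltf_pV2 ?posrE ?ltr0n// ltr_nat.
  have de0 : 0 < delta e (size s).+1 by rewrite addr_gt0 ?divr_gt0.
  pose Z b : set borelY :=
    [set y | (t%:E < h (delta e (size s).+1) (bounded_section (rcons s b) y))%E].
  have ndZ : nondecreasing_seq Z.
    move=> b b' bb; apply/subsetPset => y /= /lt_le_trans; apply.
    by apply: le_h => //; apply/subsetPset/bounded_section_nd.
  suff /ereal_sup_gt[_ [b _ <-] ab] : (a < ereal_sup (range (Pmu \o Z)))%E.
    by exists b => _; rewrite /Q size_rcons.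
  apply: (lt_le_trans Qs).
  apply: le_trans (regular_outer_bigcup (regular_mu_ext P) ndZ).
  apply: le_outer_measure => y /= ty.
  have /ereal_sup_gt[_ [b _ <-] tb] : (t%:E < ereal_sup (range (fun b =>
      h (delta e (size s).+1) (bounded_section (rcons s b) y))))%E.
    apply: lt_le_trans ty _; apply: le_trans (h_bigcup _ _ de0 ded).
    - by apply: le_h => //; exact: bounded_section_rcons.
    - exact: bounded_section_nd.
    - by move=> b; exact: bounded_sectionC.
  by exists b.
have [g gP] := choice step.
pose S := fix S l := if l is l'.+1 then rcons (S l') (g (S l')) else [::].
have SQ l : Q (S l) by elim: l => //= l ih; exact: gP.
exists (fun l => g (S l)) => l.
have -> : mkseq (fun l => g (S l)) l = S l.
  by elim: l => //= l ih; rewrite mkseqS ih.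
have sS : size (S l) = l by elim: (l) => //= l' ih; rewrite size_rcons ih.
by have := SQ l; rewrite /Q sS.
Qed.

Let closedF_rcons s b : closed (F (rcons s b)).
Proof. by case: s => [|a s]; exact: closedF. Qed.

Let F_rconsC s b : F (rcons s b) `<=` C `*` setT.
Proof. by case: s => [|a s]; exact: F_C. Qed.

Section tree.
Variable N : nat -> nat.

(** The points surviving [l] levels of the scheme below the node [s] along some
    branch bounded by [N].  The recursion descends from the root, so that each
    level is a finite union and closedness is immediate. *)
Fixpoint bounded_tree (l : nat) (s : seq nat) : set (T * Y) :=
  if l is l'.+1 then
    \big[setU/set0]_(b < (N (size s)).+1) (F (rcons s b) `&` bounded_tree l' (rcons s b))
  else setT.

Lemma bounded_treeSP l s z : bounded_tree l.+1 s z <->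
  exists b : 'I_(N (size s)).+1, F (rcons s b) z /\ bounded_tree l (rcons s b) z.
Proof.
rewrite /= -bigcup_seq; split=> [[b _ [? ?]]|[b [? ?]]]; first by exists b.
by exists b => //=; rewrite mem_index_enum.
Qed.

Lemma closed_bounded_tree l s : closed (bounded_tree l s).
Proof.
elim: l s => [|l ih] s; first exact: closedT.
by apply: closed_bigsetU => b _; apply: closedI; [exact: closedF_rcons|exact: ih].
Qed.

Lemma bounded_treeC l s : bounded_tree l.+1 s `<=` C `*` setT.
Proof.
by move=> z /bounded_treeSP[b [/F_rconsC]].
Qed.

Lemma bounded_tree_anti l s : bounded_tree l.+1 s `<=` bounded_tree l s.
Proof.
elim: l s => [//|l ih] s z /bounded_treeSP[b [Fb Tb]].
by apply/bounded_treeSP; exists b; split => //; exact: ih.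
Qed.

Lemma bounded_tree_le l l' s : (l <= l')%N -> bounded_tree l' s `<=` bounded_tree l s.
Proof.
move=> /subnK <-; elim: (l' - l)%N => // m ih z; rewrite addSn.
by move=> /bounded_tree_anti; exact: ih.
Qed.

Lemma bounded_section_tree l y :
  bounded_section (mkseq N l) y `<=` section (bounded_tree l [::]) y.
Proof.
move=> x [phi []]; rewrite size_mkseq => phiN phiF /=.
suff H m : (m <= l)%N -> bounded_tree m (mkseq phi (l - m)%N) (x, y).
  by have := H l (leqnn l); rewrite subnn.
elim: m => // m ih ml; apply/bounded_treeSP; rewrite size_mkseq.
have lm : (l - m.+1 < l)%N by rewrite -subn_gt0 subKn.
have bN : (phi (l - m.+1)%N < (N (l - m.+1)%N).+1)%N.
  by rewrite ltnS (leq_trans (phiN _ lm))// nth_mkseq.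
exists (Ordinal bN) => /=; rewrite -mkseqS; split; first exact: phiF.
by rewrite -subSn// subSS; apply: ih; exact: ltnW.
Qed.

(** Koenig's lemma for a finitely branching tree: a node with descendants at all
    levels has a child with descendants at all levels. *)
Lemma bounded_tree_branch y x :
  (forall l, bounded_tree l [::] (x, y)) -> suslin_section y x.
Proof.
move=> xT.
pose good s := forall l, bounded_tree l s (x, y).
have step s : exists b, good s -> F (rcons s b) (x, y) /\ good (rcons s b).
  have [gs|ngs] := pselect (good s); last by exists 0%N.
  have [||b bP] := @finite_pigeonhole 'I_(N (size s)).+1
    (fun b l => F (rcons s b) (x, y) /\ bounded_tree l (rcons s b) (x, y)).
  - by move=> b i j ij [? Tj]; split => //; exact: bounded_tree_le Tj.
  - by move=> l; apply/bounded_treeSP; exact: gs.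
  - by exists b => _; split; [have [] := bP 0%N | move=> l; have [] := bP l].
have [g gP] := choice step.
pose S := fix S l := if l is l'.+1 then rcons (S l') (g (S l')) else [::].
have Sgood l : good (S l) by elim: l => //= l ih; have [] := gP _ ih.
exists (fun l => g (S l)) => l.
have -> : mkseq (fun l => g (S l)) l.+1 = S l.+1.
  by elim: l.+1 => // m ih; rewrite mkseqS ih.
by have [] := gP _ (Sgood l).
Qed.

End tree.

(** The measurable set is the intersection over [l] of the sets where the
    content of the bounded tree of depth [l.+1] is at least [t]. *)
Lemma suslin_section_inner (a : \bar R) (t e : R) : 0 < e ->
  (a < Pmu [set y | t%:E < h e (suslin_section y)])%E ->
  exists W : set borelY, [/\ measurable W,
    W `<=` [set y | t%:E <= h (e / 2) (suslin_section y)]%E & (a <= P W)%E].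
Proof.
move=> e0 /(choose_bound e0)[N NP].
pose W l : set borelY :=
  [set y | (t%:E <= h (e / 2) (section (bounded_tree N l.+1 [::]) y))%E].
have mW l : measurable (W l).
  rewrite -[W l]setCK; apply: measurableC; apply: sub_sigma_algebra.
  rewrite (_ : ~` W l = [set y | (h (e / 2) (section (bounded_tree N l.+1 [::]) y) < t%:E)%E]).
    by apply: open_content_lt; [exact: closed_bounded_tree | exact: bounded_treeC].
  by apply/seteqP; split => y /=; rewrite ltNge => /negP.
have niW : nonincreasing_seq W.
  move=> l l' ll; apply/subsetPset => y /= /le_trans; apply; apply: le_h => // x.
  exact: bounded_tree_le.
have aW l : (a <= P (W l))%E.
  apply: (le_trans (ltW (NP l.+1))); rewrite -[leRHS]measurable_mu_extE//.
  apply: le_outer_measure => y /= /ltW /le_trans; apply; apply: le_h.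
    by rewrite lerDl !divr_ge0// ltW.
  exact: bounded_section_tree.
exists (\bigcap_l W l); split.
- exact: bigcap_measurable.
- move=> y Wy /=; apply: (@le_trans _ _
    (h (e / 2) (\bigcap_l section (bounded_tree N l.+1 [::]) y))); last first.
    apply: le_h => // x xT; apply: (@bounded_tree_branch N) => -[//|l].
    exact: xT.
  apply: content_bigcap_compact.
  + move=> l; have := @closed_bounded_tree N l.+1 [::].
    move=> cT; apply: (preimage_closed (f := fun x : T => (x, y))) cT => x _.
    by apply: cvg_pair => //=; exact: cvg_cst.
  + by move=> l x xT; have [] := @bounded_treeC N l [::] _ xT.
  + move=> l l' ll; apply/subsetPset => x; exact: bounded_tree_le.
  + by move=> l; exact: Wy.
- have cvgW : P (W l) @[l --> \oo] --> P (\bigcap_l W l).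
    apply: (@nonincreasing_cvg_mu _ _ _ P) => //.
    + by rewrite -ge0_fin_numE// fin_num_measure.
    + exact: bigcap_measurable.
  rewrite -(cvg_lim _ cvgW)//; apply: lime_ge; last exact: nearW.
  by apply/cvg_ex; eexists; exact: cvgW.
Qed.

(** Here [{t < S}] is the increasing union of the sets
    [{t + 1 / j.+1 < h (1 / j.+1)}]; the margin [1 / j.+1] absorbs the passage
    from a strict to a large inequality in [suslin_section_inner]. *)
Theorem suslin_section_caratheodory (t : R) :
  Pmu.-caratheodory
    [set y | t%:E < ereal_sup [set h e (suslin_section y) | e in [set e : R | (0 < e)%R]]]%E.
Proof.
apply: inner_regular_caratheodory => a.
set B := (X in Pmu X) => aB.
pose Z (j : nat) : set borelY :=
  [set y | ((t + j.+1%:R^-1)%:E < h j.+1%:R^-1 (suslin_section y))%E].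
have inv0 (j : nat) : 0 < j.+1%:R^-1 :> R by rewrite invr_gt0.
have ndZ : nondecreasing_seq Z.
  move=> i j ij; apply/subsetPset => y; rewrite /Z/= => ty.
  have ji : j.+1%:R^-1 <= i.+1%:R^-1 :> R by rewrite lef_pV2 ?posrE ?ltr0n// ler_nat.
  by apply: (@le_lt_trans _ _ (t + i.+1%:R^-1)%:E);
    [rewrite lee_fin lerD2l | apply: (lt_le_trans ty); exact: le_h].
have BZ : B `<=` \bigcup_j Z j.
  move=> y /= /ereal_sup_gt[_ [e /= e0 <-] te].
  have [t' tt' t'h] : exists2 t', t < t' & (t'%:E <= h e (suslin_section y))%E.
    case: (h e _) te => [r|_|//]; first by rewrite lte_fin => tr; exists r.
    by exists (t + 1); rewrite ?leey// ltrDl.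
  have t0 : 0 < t' - t by rewrite subr_gt0.
  near \oo => j.
  have je : j.+1%:R^-1 <= e.
    by apply: ltW; near: j; exact: near_infty_natSinv_lt (PosNum e0).
  have jt : j.+1%:R^-1 < t' - t.
    by near: j; exact: near_infty_natSinv_lt (PosNum t0).
  exists j => //; rewrite /Z/=; apply: (@lt_le_trans _ _ t'%:E).
    by rewrite lte_fin -ltrBrDl.
  by apply: (le_trans t'h); exact: le_h.
have /ereal_sup_gt[_ [j _ <-] aj] : (a < ereal_sup (range (Pmu \o Z)))%E.
  apply: (lt_le_trans aB).
  apply: le_trans (regular_outer_bigcup (regular_mu_ext P) ndZ).
  exact: le_outer_measure.
have [W [mW WB aW]] := suslin_section_inner (inv0 j) aj.
exists W; split => // y /WB /= hy; apply: (@lt_le_trans _ _ (t + j.+1%:R^-1)%:E).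
  by rewrite lte_fin ltrDl.
by apply: (le_trans hy); apply: ereal_sup_ubound; exists (j.+1%:R^-1 / 2) => //=; rewrite divr_gt0.
Unshelve. all: by end_near. Qed.

End capacitability.

(** * Configurations and superposition *)

Section config_topology.
Context {R : realType} {n : nat}.
Local Notation X := ('rV[R]_n).
Local Notation borelX := (@borel_rV R n).

Definition config_integral (f : X -> R) (gamma : config R n) : R :=
  \int[config_measure gamma]_(x in setT) f x.

Lemma config_mass_inj (gamma gamma' : config R n) : mass gamma = mass gamma' -> gamma = gamma'.
Proof.
case: gamma gamma' => [m Pm] [m' Pm']; rewrite /mass/= => mm.
have E : m = m' by exact: eq_measure.
by move: Pm'; rewrite -E => Pm'; rewrite (Prop_irrelevance Pm Pm').
Qed.

(** The vague topology is initial for the integrals of the functions in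
    [Cc]. *)
Lemma cvg_config {W : Type} (F : set_system W) (g : W -> config R n) (gamma : config R n) :
  Filter F ->
  (forall f, Cc f -> config_integral f (g w) @[w --> F] --> config_integral f gamma) ->
  g @ F --> gamma.
Proof.
move=> FF H A; rewrite nbhsE => -[_ [[B sB <-] [V BV Vg]] sUBA].
rewrite nbhs_filterE; apply: filterS sUBA _; apply: (@filterS _ _ _ V).
  by move=> ? ?; exists V.
have /sB [D sD IDeV] := BV; rewrite -IDeV; apply: filter_bigI => E DE.
have := sD _ DE; rewrite inE => -[CE oE].
apply: (H _ CE); apply: open_nbhs_nbhs; split => //.
by move: Vg; rewrite -IDeV => /(_ _ DE).
Qed.

Lemma continuous_config_integral f : Cc f -> continuous (config_integral f).
Proof.
move=> Cf; apply/continuousP => U oU.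
pose i : ((X -> R) * set R)%type := (f, U).
exists [set [set gamma | U (config_integral f gamma)]]; last first.
  by rewrite bigcup_set1.
move=> _ ->; exists (finmap.fset1 i) => [j|].
  by rewrite finmap.inE => /eqP ->; rewrite inE.
apply/seteqP; split => [gamma /(_ i)|gamma Ug j /=].
  by apply; rewrite /= finmap.inE.
by rewrite finmap.inE => /eqP ->.
Qed.

End config_topology.

Section integration.
Context {R : realType} {n : nat}.
Local Notation X := ('rV[R]_n).
Local Notation borelX := (@borel_rV R n).

Lemma continuous_measurable_borel (f : X -> R) :
  continuous f -> measurable_fun setT (f : borelX -> R).
Proof.
move=> cf; apply: (measurability _ (RGenOpens.measurableE R)) => _ [_ [a [b ->] <-]].
rewrite setTI; apply: sub_sigma_algebra; apply: open_comp => // x _; exact: cf.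
Qed.

Lemma Cc_bounded (f : X -> R) : Cc f -> exists M, forall x, `|f x| <= M.
Proof.
move=> [cf cK]; set K := closure _ in cK.
have : compact (f @` K) by apply: continuous_compact => //; exact: continuous_subspaceT.
move=> /compact_bounded [M [Mr MP]]; exists (Num.max 0 (M + 1)) => x.
have [->|fx] := eqVneq (f x) 0; first by rewrite normr0 le_max lexx.
rewrite le_max; apply/orP; right; apply: MP; first by rewrite ltrDl.
by exists x => //; exact: subset_closure.
Qed.

Lemma Cc_integrable (gamma : config R n) (f : X -> R) : Cc f ->
  (config_measure gamma).-integrable setT (EFin \o (f : borelX -> R)).
Proof.
move=> Cf; have [M fM] := Cc_bounded Cf; case: Cf => cf cK.
set K := closure _ in cK.
have mK : measurable (K : set borelX).
  rewrite -[K]setCK; apply: measurableC; apply: sub_sigma_algebra.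
  exact/closed_openC/closed_closure.
rewrite (_ : EFin \o f = (EFin \o f) \_ K); last first.
  apply/funext => x; rewrite patchE; case: ifPn => // /negP xK /=.
  have [->//|fx] := eqVneq (f x) 0; exfalso; apply: xK; rewrite inE.
  exact: subset_closure.
apply: (proj1 (@integrable_mkcond _ borelX R (config_measure gamma) K (EFin \o f) mK)).
apply: (@measurable_bounded_integrable _ borelX R (config_measure gamma) f K mK).
- by case: gamma => m [? + ?]; exact.
- by apply: measurable_funTS; exact: continuous_measurable_borel.
- by exists M; split; [exact: num_real | move=> M' MM' x _; exact: le_trans (fM x) (ltW MM')].
Qed.

Lemma integral_diracs (y : nat -> borelX) (k : nat) (f : borelX -> R) :
  measurable_fun setT f ->
  (\int[msum (fun i => \d_(y i)) k]_x (f x)%:E = (\sum_(i < k) f (y i))%:E)%E.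
Proof.
move=> mf; have mEf : measurable_fun setT (EFin \o f) by exact/measurable_EFinP.
rewrite integralE !ge0_integral_measure_sum//; last 2 first.
- exact: measurable_funeneg.
- exact: measurable_funepos.
rewrite (eq_bigr (fun i : 'I_k => (Num.max (f (y i)) 0)%:E)) => [|i _]; last first.
  rewrite integral_dirac ?diracT ?mul1e//; last exact: measurable_funepos.
  by rewrite funeposE /= EFin_max.
rewrite [X in (_ - X)%E](eq_bigr
  (fun i : 'I_k => (Num.max (- f (y i)) 0)%:E)) => [|i _]; last first.
  rewrite integral_dirac ?diracT ?mul1e//; last exact: measurable_funeneg.
  by rewrite funenegE /= EFin_max.
rewrite !sumEFin -EFinB -sumrB; congr (_%:E); apply: eq_bigr => i _.
rewrite /Num.max; case: ltP => h1; case: ltP => h2; lra.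
Qed.

Lemma integrable_diracs (y : nat -> borelX) (k : nat) (f : borelX -> R) :
  measurable_fun setT f ->
  (msum (fun i => \d_(y i)) k).-integrable setT (EFin \o f).
Proof.
move=> mf; apply/integrableP; split; first exact/measurable_EFinP.
rewrite -[X in (X < _)%E]/(\int[_]_x (`|f x|)%:E)%E.
rewrite (@integral_diracs y k (fun x => `|f x|)) ?ltry//.
exact: measurableT_comp.
Qed.

End integration.

Section superposition.
Context {R : realType} {n k : nat} (r : R).
Local Notation X := ('rV[R]_n).
Local Notation borelX := (@borel_rV R n).

Definition point_seq (x : 'M[R]_(k, n)) (i : nat) : borelX :=
  if insub i is Some j then row j x else 0.

Lemma sk_msum (x : 'M[R]_(k, n)) (S : set X) :
  sk x S = msum (fun i => \d_(point_seq x i)) k S.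
Proof. by apply: eq_bigr => i _; rewrite /point_seq valK. Qed.

Lemma sk_lt_pinfty (x : 'M[R]_(k, n)) (S : set X) : (sk x S < +oo)%E.
Proof.
by rewrite /sk; under eq_bigr do rewrite diracE; rewrite sumEFin ltry.
Qed.

Lemma sk_point (x : 'M[R]_(k, n)) (z : X) : distinct_tuples r x ->
  sk x [set z] = 0%E \/ sk x [set z] = 1%E.
Proof.
move=> [_ dx]; have [[i iz]|nz] := pselect (exists i, row i x = z); last first.
  left; rewrite /sk big1// => i _; rewrite diracE memNset// => iz.
  by apply: nz; exists i.
right; rewrite /sk (bigD1 i)//= big1 ?adde0 => [|j ji].
  by rewrite diracE mem_set.
rewrite diracE memNset// => jz; have /eqP := dx _ _ ji; apply.
by rewrite iz jz.
Qed.

Lemma sk_notin_cball (x : 'M[R]_(k, n)) (z : X) : distinct_tuples r x -> ~ cball r z ->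
  sk x [set z] = 0%E.
Proof.
move=> [bx _] nz; rewrite /sk big1// => i _; rewrite diracE memNset// => iz.
by apply: nz; rewrite -iz; exact: bx.
Qed.

Lemma mass_le (gamma : config R n) (S S' : set X) : S `<=` S' ->
  (mass gamma S <= mass gamma S')%E.
Proof.
case: gamma => m [[D [y mE]] ? ?] SS; rewrite /mass/= !mE.
apply: le_esum => i _; rewrite !diracE lee_fin ler_nat.
by case: (boolP (y i \in S)) => // /set_mem/SS/mem_set ->.
Qed.

(** The atoms of the sum are the rows of [x] followed by the atoms of [eta].
    They are pairwise distinct because [eta] charges no point of the ball. *)
Lemma superpose_exists (x : 'M[R]_(k, n)) (eta : config R n) :
  distinct_tuples r x -> Upsilon (~` cball r) eta ->
  exists zeta : config R n, mass zeta = (sk x \+ mass eta)%E.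
Proof.
move=> dx eta0.
pose m := measure_add (msum (fun i => \d_(point_seq x i)) k) (config_measure eta).
have mE S : m S = (sk x S + mass eta S)%E by rewrite /m measure_addE sk_msum.
suff mC : is_config m by exists (Config mC); apply/funext => S; exact: mE.
split.
- have [[D [y yE]] _ _] := config_measureP eta.
  exists (`I_k `|` addn k @` D), (fun i => if (i < k)%N then point_seq x i else y (i - k)%N).
  move=> S; rewrite [LHS]mE (esumID `I_k)//; congr (_ + _)%E.
    rewrite setUK esum_fset; [|exact: finite_II|by []].
    rewrite sk_msum /msum -fsbig_ord; apply: eq_bigr => i _.
    by rewrite ltn_ord.
  rewrite setIUl setICr set0U (_ : _ `&` _ = addn k @` D); last first.
    apply/seteqP; split => [i []//|_ [i Di <-]]; split; first by exists i.
    by move=> /=; rewrite ltnNge leq_addr.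
  rewrite esum_image; last by move=> i j _ _ /addnI.
  rewrite /mass/= yE; apply: eq_esum => i _.
  by rewrite ltnNge leq_addr/= addKn.
- move=> K cK; rewrite [ltLHS]mE lte_add_pinfty ?sk_lt_pinfty//.
  by have [_ + _] := config_measureP eta; exact.
- move=> z; suff [mz|mz] : (sk x [set z] + mass eta [set z] = 0 \/
      sk x [set z] + mass eta [set z] = 1)%E.
  + by left; rewrite -mz; exact: mE.
  + by right; rewrite -mz; exact: mE.
  have [bz|nz] := pselect (cball r z).
    have -> : mass eta [set z] = 0%E.
      apply/eqP; rewrite eq_le measure_ge0 andbT -[leRHS]eta0.
      by apply: mass_le => _ ->; exact.
    by rewrite adde0; exact: sk_point.
  rewrite sk_notin_cball// add0e; by have [_ _] := config_measureP eta; exact.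
Qed.

(** A default value makes it total, so that it can be a factor of limits and
    preimages; [mass_superpose] gives its meaning where [superpose_exists]
    applies. *)
Definition superpose (x : 'M[R]_(k, n)) (eta : config R n) : config R n :=
  xget config0 [set zeta | mass zeta = (sk x \+ mass eta)%E].

Lemma mass_superpose (x : 'M[R]_(k, n)) (eta : config R n) :
  distinct_tuples r x -> Upsilon (~` cball r) eta ->
  mass (superpose x eta) = (sk x \+ mass eta)%E.
Proof.
move=> dx eta0; rewrite /superpose; case: xgetP => // nz.
by have [z] := superpose_exists dx eta0; move/nz.
Qed.

Lemma config_integral_superpose (f : X -> R) (x : 'M[R]_(k, n)) (eta : config R n) :
  Cc f -> distinct_tuples r x -> Upsilon (~` cball r) eta ->
  config_integral f (superpose x eta) = \sum_i f (row i x) + config_integral f eta.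
Proof.
move=> Cf dx eta0; have mf := continuous_measurable_borel Cf.1.
rewrite /config_integral /Rintegral.
rewrite (@eq_measure_integral _ _ _ _
  (measure_add (msum (fun i => \d_(point_seq x i)) k) (config_measure eta))); last first.
  move=> A _ _; have := mass_superpose dx eta0; rewrite /mass => ->.
  by rewrite /= sk_msum; exact/esym/measure_addE.
rewrite integral_measure_add//; last 2 first.
- exact: integrable_diracs.
- exact: Cc_integrable.
rewrite integral_diracs// fineD//; last exact/integrable_fin_num/Cc_integrable.
by congr (_ + _)%R; apply: eq_bigr => i _; rewrite /point_seq valK.
Qed.

End superposition.

Section suslin_relation.
Context {R : realType} {n k : nat} (r : R).
Local Notation X := ('rV[R]_n).
Local Notation M := ('M[R]_(k, n)).
Local Notation Y := (UpsilonT (~` @cball R n r)).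

Lemma sk_preimage_sectionE (A : set (config R n)) (eta : config R n) :
  Upsilon (~` cball r) eta ->
  sk_preimage r (config_sectionk A r k eta) =
    [set x : M | distinct_tuples r x /\ A (superpose x eta)].
Proof.
move=> eta0; apply/seteqP; split => x [dx].
  move=> [gamma [[_ [zeta Azeta zE]] _] gE]; split => //.
  suff -> : superpose x eta = zeta by [].
  by apply: config_mass_inj; rewrite (mass_superpose (r := r))// zE gE.
move=> Ax; split => //; exists (superpose x config0); last first.
  rewrite (mass_superpose (r := r))//.
  by apply/funext => S /=; rewrite adde0.
have massE : mass (superpose x config0) = sk x.
  rewrite (mass_superpose (r := r))//.
  by apply/funext => S /=; rewrite adde0.
have inB : Upsilon (cball r) (superpose x config0).
  rewrite /Upsilon/= massE /sk big1// => i _; rewrite diracE memNset//.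
  by apply; case: dx => + _; exact.
split; first split => //.
  by exists (superpose x eta) => //; rewrite (mass_superpose (r := r))// massE.
split => //=; rewrite massE /sk (eq_bigr (fun=> 1%E)) => [|i _].
  by rewrite sumEFin sumr_const card_ord.
by rewrite diracE mem_set//; case: dx => + _; exact.
Qed.

(** A countable exhaustion of the distinct tuples by compact sets: being
    distinct is an open condition. *)
Definition separated_tuples (q : nat) : set M :=
  [set x | (forall i, cball r (row i x)) /\
    forall i j, i != j -> q.+1%:R^-1 <= enorm (row i x - row j x)].

Lemma separated_tuples_distinct q : separated_tuples q `<=` distinct_tuples r.
Proof.
move=> x [bx sx]; split => // i j ij; apply/eqP => xij.
by have := sx i j ij; rewrite xij subrr enorm0 leNgt invr_gt0 ltr0n.
Qed.

Lemma distinct_tuplesE : distinct_tuples r = \bigcup_q separated_tuples q.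
Proof.
apply/seteqP; split => [x [bx dx]|x [q _ /separated_tuples_distinct//]].
have /choice[g gP] : forall p : 'I_k * 'I_k, exists q : nat, p.1 != p.2 ->
    q.+1%:R^-1 <= enorm (row p.1 x - row p.2 x).
  move=> [i j]; have [->|ij] := eqVneq i j; first by exists 0%N => /=.
  have e0 : 0 < enorm (row i x - row j x).
    rewrite lt_def enorm_ge0 andbT; apply: contraNneq (dx i j ij) => e0.
    rewrite -subr_eq0; apply/eqP/matrixP => a b; rewrite [RHS]mxE.
    by apply/eqP; rewrite -normr_le0 -e0 le_enorm_entry.
  by near \oo => q; exists q => _; apply: ltW; near: q; exact: near_infty_natSinv_lt (PosNum e0).
exists (\max_p g p)%N => //; split => // i j ij.
apply: le_trans (gP (i, j) ij); rewrite lef_pV2 ?posrE ?ltr0n// ler_nat ltnS.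
exact: leq_bigmax.
Unshelve. all: by end_near. Qed.

Lemma continuous_row i : continuous (fun x : M => row i x : X).
Proof.
move=> x A /nbhs_ballP[e e0 eA]; apply/nbhs_ballP; exists e => // y xy.
by apply: eA; split => // a b; rewrite !mxE; exact: xy.2.
Qed.

Lemma closed_separated_tuples q : closed (separated_tuples q).
Proof.
have -> : separated_tuples q =
    (\bigcap_i [set x : M | enorm (row i x - 0) <= r]) `&`
    \bigcap_(p in [set p : 'I_k * 'I_k | p.1 != p.2])
      [set x : M | q.+1%:R^-1 <= enorm (row p.1 x - row p.2 x - 0)].
  apply/seteqP; split => x [bx sx]; split.
  - by move=> i _ /=; rewrite subr0; exact: bx.
  - by move=> [i j] /= ij; rewrite subr0; exact: sx.
  - by move=> i; have := bx i I; rewrite /= subr0.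
  - by move=> i j ij; have := sx (i, j) ij; rewrite /= subr0.
apply: closedI; apply: closed_bigI.
  move=> i _; apply: (@preimage_closed _ _ (fun x : M => enorm (row i x - 0)) [set t | t <= r]).
    move=> x _; apply: (@continuous_comp _ _ _
      (fun x : M => row i x : X) (fun y => enorm (y - 0))).
      exact: continuous_row.
    exact: continuous_enormB.
  exact: closed_le.
move=> [i j] _ /=.
apply: (@preimage_closed _ _ (fun x : M => enorm (row i x - row j x - 0)) [set t | q.+1%:R^-1 <= t]).
  move=> x _; apply: (@continuous_comp _ _ _
    (fun x : M => row i x - row j x : X) (fun y => enorm (y - 0))).
    exact: (@continuousB _ _ _ _ _ x (@continuous_row i x) (@continuous_row j x)).
  exact: continuous_enormB.
exact: closed_ge.
Qed.

(** Against [f] in [Cc] the superposition integrates to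
    [\sum_i f (row i x) + \int f d eta], which is jointly continuous. *)
Lemma cvg_superpose (z : M * Y) : distinct_tuples r z.1 ->
  superpose w.1 (set_val w.2) @[w --> within [set w | distinct_tuples r w.1] (nbhs z)]
    --> superpose z.1 (set_val z.2).
Proof.
move=> dz; have Uv (y : Y) : Upsilon (~` cball r) (set_val y) by exact/set_mem/(valP y).
apply: cvg_config => f Cf.
rewrite (config_integral_superpose (r := r))//.
apply: (@cvg_trans _ ((\sum_i f (row i w.1) + config_integral f (set_val w.2))
    @[w --> within [set w : M * Y | distinct_tuples r w.1] (nbhs z)])).
  apply: near_eq_cvg; near=> w; rewrite (config_integral_superpose (r := r))//.
  by near: w; exact: withinT.
apply: cvg_within_filter; apply: cvgD.
  apply: (@continuous_comp _ _ _ fst (fun x : M => \sum_i f (row i x))); first exact: cvg_fst.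
  apply: continuous_big => [|i _]; first exact: add_continuous.
  by move=> x; apply: continuous_comp; [exact: continuous_row | exact: Cf.1].
apply: (@continuous_comp _ _ _ snd (fun y : Y => config_integral f (set_val y))).
  exact: cvg_snd.
apply: (@continuous_comp _ _ _ (set_val : Y -> _) (config_integral f)).
  exact: initial_continuous.
exact: continuous_config_integral.
Unshelve. all: by end_near. Qed.

Lemma closed_superpose q (E : set (config R n)) : closed E ->
  closed [set z : M * Y | separated_tuples q z.1 /\ E (superpose z.1 (set_val z.2))].
Proof.
move=> cE; rewrite -openC openE => z nz.
have [sz|nsz] := pselect (separated_tuples q z.1); last first.
  have : nbhs z.1 (~` separated_tuples q).
    by apply: open_nbhs_nbhs; split => //; exact/closed_openC/closed_separated_tuples.
  move=> nb; exists (~` separated_tuples q, setT); first by split => //; exact: filterT.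
  by move=> [x y] [/= nx _] [].
have nEz : (~` E) (superpose z.1 (set_val z.2)) by move=> Ez; apply: nz.
have zE : nbhs z [set w : M * Y | distinct_tuples r w.1 ->
    (~` E) (superpose w.1 (set_val w.2))].
  exact: cvg_superpose (separated_tuples_distinct sz) _
    (open_nbhs_nbhs (conj (closed_openC cE) nEz)).
rewrite /interior/=; apply: filterS zE => w wE [sw Ew].
exact: wE (separated_tuples_distinct sw) Ew.
Qed.

Variable E : seq nat -> set (config R n).
Hypothesis closedE : forall s, closed (E s).

(** The first index selects the compact set of separated tuples, and the
    following ones run through the scheme of [A]; this writes the union over
    the exhaustion as part of the Suslin operation. *)
Definition section_scheme (s : seq nat) : set (M * Y) :=
  match s with
  | [::] => setT
  | [:: q] => [set z | separated_tuples q z.1]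
  | q :: s' => [set z | separated_tuples q z.1 /\ E s' (superpose z.1 (set_val z.2))]
  end.

Lemma closed_section_scheme a s : closed (section_scheme (a :: s)).
Proof.
case: s => [|b s] /=; last exact: closed_superpose.
apply: (preimage_closed (f := fst)); last exact: closed_separated_tuples.
by move=> z _; exact: cvg_fst.
Qed.

Lemma section_scheme_bounded a s :
  section_scheme (a :: s) `<=` [set x : M | forall i j, `|x i j| <= r] `*` setT.
Proof.
move=> z sz; split => // i j; have [bz _] : separated_tuples a z.1 by case: s sz => [|b s] // [].
by apply: le_trans (bz i); have := le_enorm_entry (row i z.1) ord0 j; rewrite mxE.
Qed.

Lemma mkseqSl (f : nat -> nat) l : mkseq f l.+1 = f 0%N :: mkseq (f \o S) l.
Proof. by rewrite /mkseq /= -[1%N]addn0 iotaDl -map_comp. Qed.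

Lemma suslin_sectionE (y : Y) :
  suslin_section section_scheme y =
  sk_preimage r (config_sectionk
    (\bigcup_(phi in [set: nat -> nat]) \bigcap_(l in [set l | (1 <= l)%N]) E (mkseq phi l))
    r k (set_val y)).
Proof.
rewrite sk_preimage_sectionE; last exact/set_mem/(valP y).
apply/seteqP; split => x.
  move=> [phi phiF]; split.
    by have /= := phiF 0%N; exact: separated_tuples_distinct.
  exists (phi \o S) => // -[//|l] _.
  by have := phiF l.+1; rewrite !mkseqSl => -[].
move=> []; rewrite distinct_tuplesE => -[q _ sx] [phi _ phiE].
exists (fun i => if i is i'.+1 then phi i' else q) => -[//|l].
by have := phiE l.+1 isT; rewrite !mkseqSl.
Qed.

End suslin_relation.

Theorem proposition3p6 (R : realType) (n : nat) (m : R)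
    (m_ge0 : 0 <= m) (m_le_n : m <= n%:R)
    (A : set (config R n)) (suslinA : suslin A) :
  Dm m A.
Proof.
have [E [closedE ->]] := suslinA.
move=> r /= r0 P _ k; apply: completion_measurableP => t.
pose F := @section_scheme R n k r E.
pose d := (n * k)%:R - m.
(* Without points, [d] may be negative, but the ambient space is a point. *)
have d0 : 0 <= d \/ @unit_diam R k n = 0.
  case: (k) @d => [|k'] d; first by right; exact: unit_diam0.
  left; rewrite subr_ge0 (le_trans m_le_n)// ler_nat; exact: leq_pmulr.
rewrite (_ : [set y | _] = [set y | (t%:E < ereal_sup
    [set spherical_content d e (suslin_section F y) | e in [set e : R | (0 < e)%R]])%E]); last first.
  by apply/seteqP; split => y /=; rewrite suslin_sectionE -spherical_hausdorff_sup.
apply: (@suslin_section_caratheodory R 'M[R]_(k, n) _ (spherical_content d)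
  [set x : 'M[R]_(k, n) | forall i j, `|x i j| <= r]).
- exact: le_spherical_content.
- move=> e e' S ndS SC e0 ee.
  apply: (@spherical_content_bigcup _ _ _ _
    (Num.sqrt (\sum_(i < k) \sum_(j < n) r ^+ 2))) => // i x /SC xr.
  rewrite /= /enorm ler_wsqrtr//; apply: ler_sum => a _; apply: ler_sum => b _.
  by rewrite -real_normK ?num_real// lerXn2r ?nnegrE ?(ltW r0).
- exact: spherical_content_open.
- exact: compact_entries.
- exact: closed_section_scheme.
- exact: section_scheme_bounded.
Qed.
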